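(* Let $A$ and $B$ be two irreducible non-permutation square matrices with entries in $\{0,1\}$ (not necessarily of the same size). The following assertions are equivalent: (i) The one-sided topological Markov shifts $(X_A,\sigma_A)$ and $(X_B,\sigma_B)$ are topologically conjugate, i.e. there exists a homeomorphism $h: X_A\to X_B$ with $h\circ\sigma_A=\sigma_B\circ h$. (ii) There exists an isomorphism $\Phi:\mathcal{O}_A\to\mathcal{O}_B$ of $C^*$-algebras such that $\Phi(\mathcal{D}_A)=\mathcal{D}_B$ and $$\Phi\circ\rho^{A,f\circ h}_t=\rho^{B,f}_t\circ\Phi\qquad\text{for all } f\in C(X_B,\mathbb{Z}),\ t\in\mathbb{T},$$ where $h:X_A\to X_B$ is the homeomorphism induced by the restriction $\Phi:\mathcal{D}_A\to\mathcal{D}_B$, i.e. the homeomorphism satisfying $\Phi(a)=a\circ h^{-1}$ for $a\in\mathcal{D}_A$ under the canonical identifications $\mathcal{D}_A\cong C(X_A)$ and $\mathcal{D}_B\cong C(X_B)$.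
   Context: Let $A=[A(i,j)]_{i,j=1}^N$ be an $N\times N$ matrix with entries in $\{0,1\}$. It is irreducible if for all $i,j$ there is $n\ge 1$ with $A^n(i,j)>0$; non-permutation means that $A$ is not a permutation matrix. One-sided topological Markov shift: $X_A$ is the compact Hausdorff space of sequences $(x_n)_{n\in\mathbb{N}}$ with $x_n\in\{1,\dots,N\}$ and $A(x_n,x_{n+1})=1$ for all $n\in\mathbb{N}$, with the relative topology of the product topology on $\{1,\dots,N\}^{\mathbb{N}}$ (indices start at $1$), and $\sigma_A:X_A\to X_A$, $\sigma_A((x_n)_{n\in\mathbb{N}})=(x_{n+1})_{n\in\mathbb{N}}$, which is a continuous surjection. Cuntz–Krieger algebra: $\mathcal{O}_A$ is the universal unital $C^*$-algebra generated by $N$ partial isometries $S_1,\dots,S_N$ satisfying $1=\sum_{j=1}^N S_jS_j^*$ and $S_i^*S_i=\sum_{j=1}^N A(i,j)S_jS_j^*$ for $i=1,\dots,N$. $\mathcal{D}_A\subset\mathcal{O}_A$ is the commutative $C^*$-subalgebra generated by the projections $S_{\mu_1}\cdots S_{\mu_m}S_{\mu_m}^*\cdots S_{\mu_1}^*$, $\mu_1,\dots,\mu_m\in\{1,\dots,N\}$. It is canonically isomorphic to $C(X_A)$ (complex valued continuous functions on $X_A$) by identifying $S_{\mu_1}\cdots S_{\mu_m}S_{\mu_m}^*\cdots S_{\mu_1}^*$ with the characteristic function of the cylinder set $U_{\mu_1\cdots\mu_m}=\{(x_n)_{n\in\mathbb{N}}\in X_A\mid x_1=\mu_1,\dots,x_m=\mu_m\}$.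 $C(X_A,\mathbb{Z})$ denotes the integer valued continuous functions on $X_A$, and $\mathbb{T}=\mathbb{R}/\mathbb{Z}$. For $g\in C(X_A,\mathbb{Z})$, the gauge action with potential $g$ is the action $\rho^{A,g}$ of $\mathbb{T}$ on $\mathcal{O}_A$ by the automorphisms $\rho^{A,g}_t$, $t\in\mathbb{T}$, determined by $\rho^{A,g}_t(S_j)=\exp(2\pi\sqrt{-1}\,t\,g)\cdot S_j$ for $j=1,\dots,N$, where $\exp(2\pi\sqrt{-1}\,t\,g)\in C(X_A)$ is regarded as an element of $\mathcal{D}_A\subset\mathcal{O}_A$. The same definitions and notation are used for $B$. *)

(* Defs.v *)
From HB Require Import structures.
From mathcomp Require Import all_boot all_order all_algebra.
From mathcomp Require Import complex.
From mathcomp Require Import all_classical all_reals all_analysis.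

Set Implicit Arguments.
Unset Strict Implicit.
Unset Printing Implicit Defensive.

Import Order.TTheory GRing.Theory Num.Theory.
Import numFieldNormedType.Exports.

Local Open Scope classical_set_scope.
Local Open Scope ring_scope.

(* Unital C*-algebras over the complex numbers R[i].  The norm is R-valued and
   completeness is stated with Cauchy sequences: the normed modules of
   MathComp-Analysis and the (noncommutative) algebras of MathComp have no
   common substructure, and Hierarchy Builder refuses a new one below both.
   An algType satisfies 1 != 0, so these are the nonzero unital C*-algebras. *)
HB.mixin Record Algebra_isCStar (R : realType) A & GRing.Algebra R[i] A := {
  cnorm : A -> R;
  star : A -> A;
  cnorm_eq0 : forall x : A, cnorm x = 0 -> x = 0;
  cnormD : forall x y : A, cnorm (x + y) <= cnorm x + cnorm y;
  cnormZ : forall (c : R[i]) (x : A),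
    cnorm (c *: x) = complex.Re `|c| * cnorm x;
  cnormM : forall x y : A, cnorm (x * y) <= cnorm x * cnorm y;
  cnorm_complete : forall u : nat -> A,
    (forall e : R, 0 < e -> exists n : nat, forall p q : nat,
       (n <= p)%N -> (n <= q)%N -> cnorm (u p - u q) < e) ->
    exists l : A, (fun n => cnorm (u n - l)) @ \oo --> (0 : R);
  starK : forall x : A, star (star x) = x;
  starD : forall x y : A, star (x + y) = star x + star y;
  starZ : forall (c : R[i]) (x : A), star (c *: x) = (c^*)%C *: star x;
  starM : forall x y : A, star (x * y) = star y * star x;
  cnorm_starM : forall x : A, cnorm (star x * x) = cnorm x ^+ 2
}.

#[short(type="cstarAlgType")]
HB.structure Definition CStarAlgebra (R : realType) :=
  {A of GRing.Algebra R[i] A & Algebra_isCStar R A}.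

Section CStarTheory.
Variable R : realType.
Implicit Types A B : cstarAlgType R.

(* Continuity of such maps is automatic, hence not required. *)
Definition star_morphism A B (phi : A -> B) : Prop :=
  [/\ linear phi, monoid_morphism phi & {morph phi : x / star x >-> star x}].

Definition star_isomorphism A B (phi : A -> B) : Prop :=
  star_morphism phi /\ bijective phi.

Definition cstar_subalgebra A (D : set A) : Prop :=
  [/\ D 0 /\ (forall (c : R[i]) x y, D x -> D y -> D (c *: x + y)),
      forall x y, D x -> D y -> D (x * y),
      forall x, D x -> D (star x)
    & forall (u : nat -> A) (l : A), (forall n, D (u n)) ->
        (fun n => cnorm (u n - l)) @ \oo --> (0 : R) -> D l].

Definition cstar_generated A (G : set A) : set A :=
  smallest (@cstar_subalgebra A) G.

Definition partial_isometry A (s : A) : Prop := s * star s * s = s.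

End CStarTheory.

Definition zero_one_matrix (N : nat) (A : 'M[nat]_N) : Prop :=
  forall i j, A i j = 0%N \/ A i j = 1%N.

Definition irreducible_matrix (N : nat) (A : 'M[nat]_N) : Prop :=
  forall i j, exists n : nat, (1 <= n)%N /\ (0 < (A ^+ n) i j)%N.

Section MarkovShift.
Variables (N : nat) (A : 'M[nat]_N).

Definition full_shift : topologicalType :=
  prod_topology (fun _ : nat => discrete_topology 'I_N).

(* Sequences are indexed from 0 and letters are 0, ..., N-1.  Used as a type,
   this set carries the relative topology. *)
Definition markov_seq : set full_shift :=
  [set x | forall n : nat, A (x n) (x n.+1) = 1%N].

Definition markov_space : topologicalType := set_type markov_seq.

Lemma shift_subproof (x : markov_space) :
  (fun n => set_val x n.+1) \in markov_seq.
Proof. by apply/mem_set => n /=; have /set_mem := valP x; apply. Qed.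

Definition markov_shift (x : markov_space) : markov_space :=
  exist (fun y => y \in markov_seq) _ (shift_subproof x).

Definition cylinder (mu : seq 'I_N) : set markov_space :=
  [set x | mkseq (set_val x) (size mu) = mu].

End MarkovShift.

Definition homeomorphism (X Y : topologicalType) (h : X -> Y) (hinv : Y -> X) :
    Prop :=
  [/\ continuous h, continuous hinv, cancel h hinv & cancel hinv h].

Section CuntzKrieger.
Variables (R : realType) (N : nat) (A : 'M[nat]_N).

Definition ck_family (O : cstarAlgType R) (S : 'I_N -> O) : Prop :=
  [/\ forall i, partial_isometry (S i),
      1 = \sum_j S j * star (S j)
    & forall i, star (S i) * S i = \sum_j (S j * star (S j)) *+ A i j].

(* Uniqueness of the induced morphism follows from generation. *)
Definition cuntz_krieger (O : cstarAlgType R) (S : 'I_N -> O) : Prop :=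
  [/\ ck_family S,
      cstar_generated (range S) = [set: O]
    & forall (E : cstarAlgType R) (T : 'I_N -> E), ck_family T ->
        exists phi : O -> E, star_morphism phi /\ forall j, phi (S j) = T j].

Section Gauge.
Variables (O : cstarAlgType R) (S : 'I_N -> O).

Definition word_projection (mu : seq 'I_N) : O :=
  (\prod_(i <- mu) S i) * star (\prod_(i <- mu) S i).

Definition diagonal_algebra : set O := cstar_generated (range word_projection).

Definition Cspace : set (markov_space A -> R[i]) :=
  [set f | continuous (f : markov_space A -> R[i]^o)].

Definition Cspace_int : set (markov_space A -> int) :=
  [set g | continuous (g : markov_space A -> discrete_topology int)].

(* iota is the identification of C(X_A) with the diagonal subalgebra; only its
   values on continuous functions are constrained. *)
Definition canonical_identification (iota : (markov_space A -> R[i]) -> O) :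
    Prop :=
  [/\ [/\ forall (c : R[i]) f g, Cspace f -> Cspace g ->
            iota (fun x => c * f x + g x) = c *: iota f + iota g,
          forall f g, Cspace f -> Cspace g ->
            iota (fun x => f x * g x) = iota f * iota g
        & forall f, Cspace f ->
            iota (fun x => ((f x)^*)%C) = star (iota f)],
      forall f g, Cspace f -> Cspace g -> iota f = iota g -> f = g,
      iota @` Cspace = diagonal_algebra
    & forall mu, iota (\1_(cylinder mu)) = word_projection mu].

(* For an irreducible 0-1 matrix and a universal family such an iota exists and
   is unique on Cspace, so the default value 0 is never used. *)
Definition of_Cspace : (markov_space A -> R[i]) -> O :=
  xget (fun=> 0) [set iota | canonical_identification iota].

Definition expi (theta : R) : R[i] := (cos theta +i* sin theta)%C.

(* The time t in R/Z is given by a real representative; as g is integer valued,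
   gauge_action g t depends only on t modulo 1.  For continuous g the
   automorphism exists and is unique, so the default value is never used. *)
Definition gauge_action (g : markov_space A -> int) (t : R) : O -> O :=
  xget (fun x : O => x) [set alpha | star_isomorphism alpha /\
    forall j, alpha (S j) =
      of_Cspace (fun x => expi (2 * pi * t * (g x)%:~R)) * S j].

End Gauge.
End CuntzKrieger.

(* Main.v *)
(* Write [sigma] for the shift, [iota] for the identification of C(X_A) with
   D_A, and [W] for the sum of the generators.  Then [W * iota f =
   iota (f \o sigma) * W], and [star W * iota f * W] is [iota] of the transfer
   operator of [sigma] at [f]: up to [iota], the pair (D_A, W) depends on
   (X_A, sigma) only, and S_i is the projection [iota chi_i] times [W], with
   [chi_i] the indicator of the cylinder of [i].  A conjugacy [h] therefore turns
   [iota (chi_i \o hinv) * W] into a Cuntz-Krieger family for A inside O_B, which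
   yields the isomorphism and its inverse; each gauge action multiplies [W] by a
   unitary of the diagonal, so that the isomorphism intertwines them.

   Conversely, for a coboundary f = g - g \o sigma the gauge action with potential
   [f] is the inner automorphism given by v = exp(2 pi i t g).  The intertwining
   relation then says that s = Phi(S_i) satisfies [s * iota (v^* ) =
   iota (v^* \o sigma_B) * s], while the relations of O_A say [s * iota b =
   iota (b \o h \o sigma_A \o hinv) * s].  As the elements [s * star s] add up to
   1, this gives v \o sigma_B = v \o h \o sigma_A \o hinv, and at t = 1/2 the
   functions v separate points.

   Automatic contractivity of star-morphisms and the orthogonality of projections
   with sum 1 are derived from a square root of 1 - w for self-adjoint [w] of norm
   less than 1, without spectral theory. *)

Require Import Defs.
From mathcomp Require Import all_boot all_order all_algebra.
From mathcomp Require Import complex.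
From mathcomp Require Import all_classical all_reals all_analysis.
From mathcomp Require Import ring lra.
Import Order.TTheory GRing.Theory Num.Theory.
Import numFieldNormedType.Exports.
Local Open Scope classical_set_scope.
Local Open Scope ring_scope.

Set Implicit Arguments.
Unset Strict Implicit.
Unset Printing Implicit Defensive.

(** * Real-valued modulus on [R[i]] *)

Section ComplexModulus.
Variable R : realType.
Implicit Types (r : R) (c d : R[i]).

Definition cabs c : R := complex.Re `|c|.

Lemma cabsE c : `|c| = (cabs c)%:C%C.
Proof. by case: c. Qed.

Lemma cabs_ge0 c : 0 <= cabs c.
Proof. by rewrite -ler0c -cabsE. Qed.

Lemma cabs0 : cabs 0 = 0.
Proof. by rewrite /cabs normr0. Qed.

Lemma cabs0_eq0 c : cabs c = 0 -> c = 0.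
Proof. by move=> c0; apply/eqP; rewrite -normr_eq0 cabsE c0. Qed.

Lemma cabs1 : cabs 1 = 1.
Proof. by rewrite /cabs normr1. Qed.

Lemma cabsN c : cabs (- c) = cabs c.
Proof. by rewrite /cabs normrN. Qed.

Lemma cabsM c d : cabs (c * d) = cabs c * cabs d.
Proof.
by apply: (@complexI R); rewrite [RHS]rmorphM/= -!cabsE normrM.
Qed.

Lemma cabsD c d : cabs (c + d) <= cabs c + cabs d.
Proof. by rewrite -lecR [leRHS]rmorphD/= -!cabsE ler_normD. Qed.

Lemma cabs_real r : cabs r%:C%C = `|r|.
Proof. by rewrite /cabs /= expr0n addr0 sqrtr_sqr. Qed.

Lemma cabs_conj c : cabs (c^*)%C = cabs c.
Proof. by case: c => a b; rewrite /cabs /= sqrrN. Qed.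

Lemma mulcJ c : (c^*)%C * c = (cabs c ^+ 2)%:C%C.
Proof.
rewrite rmorphXn/= -cabsE -add_Re2_Im2.
case: c => a b /=; simpc; congr (_ +i* _)%C; ring.
Qed.

Lemma cabs_im : cabs ('i)%C = 1.
Proof. by rewrite /cabs /= expr0n expr1n add0r sqrtr1. Qed.

Lemma cabs_nat n : cabs n%:R = n%:R.
Proof.
by rewrite -[n%:R](rmorph_nat (real_complex R)) cabs_real normr_nat.
Qed.

Lemma cabs_Re c : `|complex.Re c| <= cabs c.
Proof.
case: c => a b; rewrite /cabs /= -sqrtr_sqr ler_wsqrtr//.
by rewrite lerDl sqr_ge0.
Qed.

Lemma cabs_Im c : `|complex.Im c| <= cabs c.
Proof.
case: c => a b; rewrite /cabs /= -sqrtr_sqr ler_wsqrtr//.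
by rewrite lerDr sqr_ge0.
Qed.

Lemma cabs_ReIm c : cabs c <= `|complex.Re c| + `|complex.Im c|.
Proof.
rewrite {1}(complexE c) (le_trans (cabsD _ _))// cabsM cabs_im mul1r.
by rewrite !cabs_real.
Qed.

End ComplexModulus.

(** * Norm, involution and limits in a C*-algebra *)

Section CStarBasics.
Variables (R : realType) (A : cstarAlgType R).
Implicit Types (x y z : A) (c : R[i]) (r : R) (u : nat -> A).

Lemma starB x y : star (x - y) = star x - star y.
Proof. by rewrite -[- y]scaleN1r starD starZ rmorphN1 scaleN1r. Qed.

Lemma star0 : star 0 = 0 :> A.
Proof. by have := starB 0 0; rewrite !subrr. Qed.

Lemma star1 : star 1 = 1 :> A.
Proof. by have := starM (star 1) (1 : A); rewrite !mulr1 !starK mulr1. Qed.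

Lemma star_sum (I : Type) (s : seq I) (P : pred I) (F : I -> A) :
  star (\sum_(i <- s | P i) F i) = \sum_(i <- s | P i) star (F i).
Proof. exact: (big_morph _ starD star0). Qed.

Lemma cnorm0 : cnorm (0 : A) = 0.
Proof. by rewrite -(scale0r 0) cnormZ normr0 mul0r. Qed.

Lemma cnormN x : cnorm (- x) = cnorm x.
Proof. by rewrite -scaleN1r cnormZ -/(cabs _) cabsN cabs1 mul1r. Qed.

Lemma cnormC x y : cnorm (x - y) = cnorm (y - x).
Proof. by rewrite -cnormN opprB. Qed.

Lemma cnorm_ge0 x : 0 <= cnorm x.
Proof.
by have := cnormD x (- x); rewrite subrr cnorm0 cnormN; lra.
Qed.

Lemma cnormB x y : cnorm (x - y) <= cnorm x + cnorm y.
Proof. by rewrite -(cnormN y) cnormD. Qed.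

Lemma cnorm_tri z x y : cnorm (x - y) <= cnorm (x - z) + cnorm (z - y).
Proof. by rewrite (le_trans _ (cnormD _ _))// addrA subrK. Qed.

Lemma cnormZE c x : cnorm (c *: x) = cabs c * cnorm x.
Proof. exact: cnormZ. Qed.

Lemma cnormZr r x : 0 <= r -> cnorm (r%:C%C *: x) = r * cnorm x.
Proof. by move=> r0; rewrite cnormZE cabs_real ger0_norm. Qed.

Lemma cnorm_sum (I : Type) (s : seq I) (P : pred I) (F : I -> A) :
  cnorm (\sum_(i <- s | P i) F i) <= \sum_(i <- s | P i) cnorm (F i).
Proof.
apply: (big_ind2 (fun x r => cnorm x <= r)); rewrite ?cnorm0//.
by move=> x1 x2 r1 r2 h1 h2; rewrite (le_trans (cnormD _ _))// lerD.
Qed.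

(** The C*-identity and submultiplicativity give [cnorm y ^+ 2 <= cnorm (star y) * cnorm y]; cancel
    [cnorm y], and use this for both [x] and [star x]. *)
Lemma cnorm_star x : cnorm (star x) = cnorm x.
Proof.
have le y : cnorm y <= cnorm (star y).
  have [->|y0] := eqVneq (cnorm y) 0; first exact: cnorm_ge0.
  have yp : 0 < cnorm y by rewrite lt_def y0 cnorm_ge0.
  by rewrite -(ler_pM2r yp) -expr2 -cnorm_starM cnormM.
by apply/eqP; rewrite eq_le le andbT -{2}(starK x) le.
Qed.

Lemma cnorm_idem_sa x : star x = x -> x * x = x -> x != 0 -> cnorm x = 1.
Proof.
move=> sx xx x0; have := cnorm_starM x; rewrite sx xx expr2 => h.
have n0 : cnorm x != 0 by apply: contra_neq x0; exact: cnorm_eq0.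
by apply: (mulfI n0); rewrite -h mulr1.
Qed.

Lemma cnorm_idem_le1 x : star x = x -> x * x = x -> cnorm x <= 1.
Proof.
move=> sx xx; have [->|x0] := eqVneq x 0; first by rewrite cnorm0.
by rewrite cnorm_idem_sa.
Qed.

Lemma cnorm1 : cnorm (1 : A) = 1.
Proof. by rewrite cnorm_idem_sa ?star1 ?mulr1// oner_neq0. Qed.

(** The C*-identity turns an algebraic relation into a norm estimate; unitaries and reflections get
    their bounds from it below. *)
Lemma cnorm_unitary_le x m : 0 <= m ->
  star x * x = ((m ^+ 2)%:C)%C%:A -> cnorm x <= m.
Proof.
move=> m0 h; rewrite -(@ler_pXn2r _ 2)// ?nnegrE ?cnorm_ge0//.
by rewrite -cnorm_starM h cnormZr ?sqr_ge0// cnorm1 mulr1.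
Qed.

Lemma starMx_eq0 x : star x * x = 0 -> x = 0.
Proof.
move=> h; apply: cnorm_eq0; apply/eqP; rewrite -sqrf_eq0 -cnorm_starM h.
by rewrite cnorm0.
Qed.

Lemma cnorm_le_eps x : (forall e : R, 0 < e -> cnorm x <= e) -> x = 0.
Proof.
move=> h; apply: cnorm_eq0; apply/eqP; rewrite eq_le cnorm_ge0 andbT.
by apply/ler_addgt0Pl => e e0; rewrite addr0 h.
Qed.

(** Epsilon form of the limits in [cnorm_complete] and [cstar_subalgebra], handled below in place of
    filters. *)
Definition converges u l :=
  forall e : R, 0 < e -> exists n, forall p, (n <= p)%N -> cnorm (u p - l) < e.

Lemma convergesP u l :
  (fun n => cnorm (u n - l)) @ \oo --> (0 : R) <-> converges u l.
Proof.
split=> [/cvgr0Pnorm_lt h e e0|h].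
  have [n _ hn] := h e e0; exists n => p np.
  by have := hn p np; rewrite /= ger0_norm ?cnorm_ge0.
apply/cvgr0Pnorm_lt => e e0; have [n hn] := h e e0.
by exists n => // p np; rewrite /= ger0_norm ?cnorm_ge0 ?hn.
Qed.

(** Sequential closedness, the form in which a property passes from iterates to their limit. *)
Definition closed_pred (K : set A) :=
  forall u l, (forall n, K (u n)) -> converges u l -> K l.

Lemma converges_unique u l l' : converges u l -> converges u l' -> l = l'.
Proof.
move=> h h'; apply/eqP; rewrite -subr_eq0; apply/eqP.
apply: cnorm_le_eps => e e0.
have [n hn] := h (e / 2) (divr_gt0 e0 (ltr0n _ 2)).
have [n' hn'] := h' (e / 2) (divr_gt0 e0 (ltr0n _ 2)).
have := hn (maxn n n') (leq_maxl _ _); have := hn' (maxn n n') (leq_maxr _ _).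
have := cnorm_tri (u (maxn n n')) l l'; rewrite (cnormC l (u _)); lra.
Qed.

End CStarBasics.

(** The distance from [F l] to [G l] is at most [(k + k') * cnorm (u n - l)] for every [n]. *)
Lemma closed_lipschitz_eq (R : realType) (A B : cstarAlgType R) (F G : A -> B)
    (k k' : R) :
  (forall x y, cnorm (F x - F y) <= k * cnorm (x - y)) ->
  (forall x y, cnorm (G x - G y) <= k' * cnorm (x - y)) ->
  closed_pred [set x | F x = G x].
Proof.
move=> hF hG u l hu ul /=; apply/eqP; rewrite -subr_eq0; apply/eqP.
apply: cnorm_le_eps => e e0.
(* Absolute values and the added 1 keep the divisor positive, whatever the signs of [k] and [k']. *)
have k0 : 0 < `|k| + `|k'| + 1 by rewrite ltr_wpDl ?addr_ge0.
have [n hn] := ul (e / (`|k| + `|k'| + 1)) (divr_gt0 e0 k0).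
have := hn n (leqnn n); rewrite ltr_pdivlMr// => hl.
have := cnorm_tri (F (u n)) (F l) (G l); rewrite {2}(hu n) (cnormC (F l) (F _)).
have := hF (u n) l; have := hG (u n) l; have := cnorm_ge0 (u n - l).
have := ler_norm k; have := ler_norm k'.
set t := cnorm (u n - l) in hl *; nra.
Qed.

(** * Square roots by iteration, and norm comparison for self-adjoint elements *)

Section ContinuousCalculus.
Variables (R : realType) (A : cstarAlgType R).
Implicit Types (x y z : A) (c : R[i]) (r : R) (u : nat -> A).

Lemma closed_predI (K K' : set A) :
  closed_pred K -> closed_pred K' -> closed_pred (K `&` K').
Proof.
by move=> h h' u l hu ul; split; [apply: h ul|apply: h' ul] => n; case: (hu n).
Qed.

Lemma closed_commute x : closed_pred [set z | x * z = z * x].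
Proof.
apply: (@closed_lipschitz_eq R A A ( *%R x) (fun z => z * x) (cnorm x) (cnorm x)).
  by move=> z t; rewrite -mulrBr cnormM.
by move=> z t; rewrite -mulrBl [leRHS]mulrC cnormM.
Qed.

Lemma closed_sa : closed_pred [set x : A | star x = x].
Proof.
apply: (@closed_lipschitz_eq R A A (@star R A) id 1 1) => x y; rewrite mul1r//.
by rewrite -starB cnorm_star.
Qed.

Lemma closed_corner q : closed_pred [set x : A | q * x = x /\ x * q = x].
Proof.
apply: closed_predI.
  apply: (@closed_lipschitz_eq R A A ( *%R q) id (cnorm q) 1) => x y.
    by rewrite -mulrBr cnormM.
  by rewrite mul1r.
apply: (@closed_lipschitz_eq R A A (fun x => x * q) id (cnorm q) 1) => x y.
  by rewrite -mulrBl [leRHS]mulrC cnormM.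
by rewrite mul1r.
Qed.

(* The fixed point of y |-> (w + y^2) / 2 plays the role of 1 - sqrt (1 - w). *)
Lemma sqrt_fixpoint (w : A) : cnorm w < 1 ->
  exists y, y *+ 2 = w + y * y /\
    forall K : set A, closed_pred K -> K 0 ->
      (forall x, K x -> K (2^-1 *: (w + x * x))) -> K y.
Proof.
set r := cnorm w => r1; have r0 : 0 <= r by exact: cnorm_ge0.
pose F x : A := 2^-1 *: (w + x * x).
have half : cabs (2^-1 : R[i]) = 2^-1.
  apply: (@mulfI _ 2); first by rewrite pnatr_eq0.
  by rewrite divff ?pnatr_eq0// -{1}(cabs_nat R 2) -cabsM divff ?cabs1 ?pnatr_eq0.
(* As [r < 1], [(r + r ^+ 2) / 2 <= r]: the ball of radius [r] is stable under [F], and there [F] is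
   Lipschitz of ratio [r]. *)
have Fr x : cnorm x <= r -> cnorm (F x) <= r.
  move=> xr; rewrite cnormZE half.
  have := cnormD w (x * x); have := cnormM x x; have := cnorm_ge0 x.
  rewrite -/r; set t := cnorm x in xr *; nra.
have Fc x y : cnorm x <= r -> cnorm y <= r ->
    cnorm (F x - F y) <= r * cnorm (x - y).
  move=> xr yr; rewrite -scalerBr cnormZE half.
  (* Difference of squares without commutation: each of the two terms keeps a factor of norm at most
     [r]. *)
  have -> : w + x * x - (w + y * y) = x * (x - y) + (x - y) * y.
    by rewrite mulrBr mulrBl addrA subrK opprD addrACA subrr add0r.
  have := cnormD (x * (x - y)) ((x - y) * y).
  have := cnormM x (x - y); have := cnormM (x - y) y; have := cnorm_ge0 (x - y).
  set t := cnorm (x - y); nra.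
pose u n := iter n F 0.
have ur n : cnorm (u n) <= r.
  by elim: n => [|n ih]; [rewrite cnorm0|exact: Fr].
have uc n k : cnorm (u (n + k)%N - u n) <= r ^+ n.
  elim: n => [|n ih]; first by rewrite expr0 subr0 (le_trans (ur _))// ltW.
  by rewrite exprS (le_trans (Fc _ _ (ur _) (ur _)))// ler_wpM2l.
have rn e : 0 < e -> exists n, r ^+ n < e.
  move=> e0; have /cvgr0Pnorm_lt/(_ e e0)[n _ hn] : r ^+ n @[n --> \oo] --> 0.
    by apply: cvg_expr; rewrite ger0_norm.
  by exists n; have := hn n (leqnn n); rewrite /= ger0_norm ?exprn_ge0.
have [e e0|y /convergesP uy] := @cnorm_complete _ _ u.
  have [n hn] := rn (e / 2) (divr_gt0 e0 (ltr0n _ 2)).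
  exists n => p q np nq; have := cnorm_tri (u n) (u p) (u q).
  have := uc n (p - n)%N; have := uc n (q - n)%N.
  rewrite !subnKC// (cnormC (u n)); lra.
(* This induction principle is how [y] inherits self-adjointness, commutation and membership in a
   corner from [w]. *)
have yK (K : set A) : closed_pred K -> K 0 ->
    (forall x, K x -> K (F x)) -> K y.
  by move=> cK K0 KF; apply: cK uy => n; elim: n => [//|n ih]; exact: KF.
exists y; split; last exact: yK.
have yr : cnorm y <= r.
  apply/ler_addgt0Pl => e e0; have [n /(_ n (leqnn n)) hn] := uy e e0.
  have := cnorm_tri (u n) y 0; rewrite !subr0 cnormC; have := ur n; lra.
have Fy : y = F y.
  apply: (converges_unique (u := fun n => u n.+1)) => e e0.
    by have [n hn] := uy e e0; exists n => p np; rewrite hn// leqW.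
  have [n hn] := uy e e0; exists n => p np.
  rewrite (le_lt_trans (Fc _ _ (ur _) yr))// (le_lt_trans _ (hn p np))//.
  by rewrite ler_piMl ?cnorm_ge0// ltW.
rewrite {1}Fy -scaler_nat /F scalerA divff ?pnatr_eq0// scale1r //.
Qed.

Lemma step_sa (w x : A) :
  star w = w -> star x = x -> star (2^-1 *: (w + x * x)) = 2^-1 *: (w + x * x).
Proof.
by move=> sw sx; rewrite starZ starD starM sw sx conjc_inv conjc_nat.
Qed.

Lemma step_commute (w x z : A) : z * w = w * z -> z * x = x * z ->
  z * (2^-1 *: (w + x * x)) = 2^-1 *: (w + x * x) * z.
Proof.
move=> zw zx; rewrite -scalerAr -scalerAl mulrDr mulrDl zw.
by rewrite mulrA zx -mulrA zx mulrA.
Qed.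

Lemma step_corner (q w x : A) : q * w = w /\ w * q = w ->
  q * x = x /\ x * q = x ->
  q * (2^-1 *: (w + x * x)) = 2^-1 *: (w + x * x) /\
  2^-1 *: (w + x * x) * q = 2^-1 *: (w + x * x).
Proof.
move=> [qw wq] [qx xq]; rewrite -scalerAr -scalerAl mulrDr mulrDl.
by rewrite mulrA qx -mulrA xq qw wq.
Qed.

Lemma star_add_im x y : star x = x -> star y = y ->
  star (x + 'i%C *: y) = x - 'i%C *: y.
Proof.
move=> sx sy; rewrite starD starZ sx sy; congr (_ + _).
by rewrite -scaleNr; congr (_ *: _); simpc.
Qed.

Lemma mul_star_add_im x y : x * y = y * x ->
  (x - 'i%C *: y) * (x + 'i%C *: y) = x * x + y * y.
Proof.
move=> xy; set z := 'i%C *: y.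
have xz : z * x = x * z by rewrite -scalerAl -scalerAr xy.
have zz : z * z = - (y * y).
  by rewrite -scalerAl -scalerAr scalerA -expr2 sqr_i scaleN1r.
by rewrite mulrDr !mulrBl xz zz opprK addrA subrK.
Qed.

Lemma add_star_add_im x y : (x - 'i%C *: y) + (x + 'i%C *: y) = x *+ 2.
Proof. by rewrite addrCA subrK mulr2n. Qed.

(** [x] is the half-sum of [x + 'i *: y] and its adjoint, which have the same norm. *)
Lemma cnorm_le_add_im x y : star x = x -> star y = y ->
  cnorm x <= cnorm (x + 'i%C *: y).
Proof.
move=> sx sy; have := cnormD (x - 'i%C *: y) (x + 'i%C *: y).
rewrite add_star_add_im -scaler_nat cnormZE cabs_nat.
rewrite -{1}(star_add_im sx sy) cnorm_star.
by rewrite -mulr2n -[leRHS]mulr_natl ler_pM2l.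
Qed.

(** The sum of squares is the product of [x + 'i *: y] with its adjoint, so the C*-identity reduces
    the claim to [cnorm_le_add_im]. This stands in for monotonicity of the norm on positive
    elements. *)
Lemma cnorm_sa_le x y : star x = x -> star y = y -> x * y = y * x ->
  cnorm (x * x) <= cnorm (x * x + y * y).
Proof.
move=> sx sy xy; rewrite -(mul_star_add_im xy) -(star_add_im sx sy).
rewrite -{1}sx !cnorm_starM ler_pXn2r// ?nnegrE ?cnorm_ge0//.
exact: cnorm_le_add_im.
Qed.

(** Completing the square: for the [y] of [sqrt_fixpoint], [q - y] is a square root of [q - w] in
    the corner with unit [q]. *)
Lemma corner_sub_sqr q y w : q * q = q -> q * y = y /\ y * q = y ->
  y *+ 2 = w + y * y -> (q - y) * (q - y) = q - w.
Proof.
move=> qq [qy yq] h; have -> : w = y *+ 2 - y * y by rewrite h addrK.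
rewrite mulrBl !mulrBr qq qy yq !opprB -addrA mulr2n opprD; congr (_ + _).
by rewrite addrCA.
Qed.

End ContinuousCalculus.

(** * Star-morphisms: contractivity and equality on generators *)

Section StarMorphism.
Variables (R : realType) (A B : cstarAlgType R).
Variables (phi : A -> B) (mphi : star_morphism phi).
Implicit Types (x y : A) (c : R[i]).

Lemma morphismP c x y : phi (c *: x + y) = c *: phi x + phi y.
Proof. by case: mphi => l _ _; exact: l. Qed.

Lemma morphismD x y : phi (x + y) = phi x + phi y.
Proof. by rewrite -{1}[x]scale1r morphismP scale1r. Qed.

Lemma morphism0 : phi 0 = 0.
Proof. by apply: (addrI (phi 0)); rewrite -morphismD !addr0. Qed.

Lemma morphismZ c x : phi (c *: x) = c *: phi x.
Proof. by rewrite -[c *: x]addr0 morphismP morphism0 addr0. Qed.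

Lemma morphismN x : phi (- x) = - phi x.
Proof. by rewrite -scaleN1r morphismZ scaleN1r. Qed.

Lemma morphismB x y : phi (x - y) = phi x - phi y.
Proof. by rewrite morphismD morphismN. Qed.

Lemma morphism_sum (I : Type) (s : seq I) (P : pred I) (F : I -> A) :
  phi (\sum_(i <- s | P i) F i) = \sum_(i <- s | P i) phi (F i).
Proof. exact: (big_morph _ morphismD morphism0). Qed.

Lemma morphism1 : phi 1 = 1.
Proof. by case: mphi => _ [h _] _; exact: h. Qed.

Lemma morphismM x y : phi (x * y) = phi x * phi y.
Proof. by case: mphi => _ [_ h] _; exact: h. Qed.

Lemma morphism_star x : phi (star x) = star (phi x).
Proof. by case: mphi => _ _; exact. Qed.

(* [u = x + i c] with [c = sqrt (1 - x^2)] is unitary, hence so is its image,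
   of which [phi x] is the self-adjoint part. *)
Lemma morphism_sa_le1 x : star x = x -> cnorm x < 1 -> cnorm (phi x) <= 1.
Proof.
move=> sx x1; have w1 : cnorm (x * x) < 1.
  have := cnormM x x; have := cnorm_ge0 x; nra.
have [y [yw yK]] := sqrt_fixpoint w1.
have sy : star y = y.
  apply: (yK [set z : A | star z = z]); [exact: closed_sa|exact: star0|].
  by move=> z zK; apply: step_sa => //; rewrite starM sx.
have xy : x * y = y * x.
  apply: (yK [set z : A | x * z = z * x]); first exact: closed_commute.
    by rewrite /= mulr0 mul0r.
  by move=> z zK; apply: step_commute => //; rewrite mulrA.
have yc : (1 - y) * (1 - y) = 1 - x * x.
  by apply: corner_sub_sqr; rewrite ?mulr1 ?mul1r.
have sc : star (1 - y) = 1 - y by rewrite starB star1 sy.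
have xc : x * (1 - y) = (1 - y) * x by rewrite mulrBr mulrBl mulr1 mul1r xy.
have u1 : cnorm (phi (x + 'i%C *: (1 - y))) <= 1.
  apply: cnorm_unitary_le => //.
  rewrite expr1n scale1r -morphism_star -morphismM star_add_im//.
  by rewrite mul_star_add_im// yc addrC subrK morphism1.
apply: le_trans u1; rewrite morphismD morphismZ.
by apply: cnorm_le_add_im; rewrite -morphism_star ?sx ?sc.
Qed.

(** A self-adjoint [y] is scaled by the inverse of [cnorm y + e] into the open unit ball, and [e]
    tends to 0; the general case applies this to [star x * x] through the C*-identity. *)
Lemma morphism_contractive x : cnorm (phi x) <= cnorm x.
Proof.
have sa y : star y = y -> cnorm (phi y) <= cnorm y.
  move=> sy; apply/ler_addgt0Pr => e e0.
  have k0 : 0 < cnorm y + e by rewrite ltr_wpDl ?cnorm_ge0.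
  have ki : 0 < (cnorm y + e)^-1 by rewrite invr_gt0.
  have := @morphism_sa_le1 (((cnorm y + e)^-1)%:C%C *: y).
  rewrite starZ conjc_real sy morphismZ !(cnormZr _ (ltW ki)).
  rewrite ltr_pdivrMl// ler_pdivrMl// !mulr1; apply=> //.
  by rewrite ltrDl.
rewrite -(@ler_pXn2r _ 2) ?nnegrE ?cnorm_ge0// -!cnorm_starM.
by rewrite -morphism_star -morphismM sa// starM starK.
Qed.

Lemma morphism_lipschitz x y : cnorm (phi x - phi y) <= 1 * cnorm (x - y).
Proof. by rewrite -morphismB mul1r morphism_contractive. Qed.

End StarMorphism.

Section StarMorphismEquality.
Variables (R : realType) (A B C : cstarAlgType R).

Lemma star_morphism_comp (phi : A -> B) (psi : B -> C) :
  star_morphism phi -> star_morphism psi -> star_morphism (psi \o phi).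
Proof.
move=> mphi mpsi; split=> [c x y|/=|x /=].
- by rewrite /= !(morphismP mphi, morphismP mpsi).
- split=> [|x y]; first by rewrite /= (morphism1 mphi) (morphism1 mpsi).
  by rewrite /= (morphismM mphi) (morphismM mpsi).
- by rewrite (morphism_star mphi) (morphism_star mpsi).
Qed.

Lemma star_morphism_id : star_morphism (@id A).
Proof. by split. Qed.

(** Stability under limits is where contractivity of morphisms enters. *)
Lemma cstar_subalgebra_eq (phi psi : A -> B) :
  star_morphism phi -> star_morphism psi ->
  cstar_subalgebra [set x | phi x = psi x].
Proof.
move=> mphi mpsi; split=> /=.
- split=> [|c x y hx hy]; first by rewrite !morphism0.
  by rewrite (morphismP mphi) (morphismP mpsi) hx hy.
- by move=> x y hx hy; rewrite (morphismM mphi) (morphismM mpsi) hx hy.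
- by move=> x hx; rewrite (morphism_star mphi) (morphism_star mpsi) hx.
- move=> u l hu /convergesP hl; apply: closed_lipschitz_eq hu hl;
    exact: morphism_lipschitz.
Qed.

Lemma eq_on_generators (G : set A) (phi psi : A -> B) :
  star_morphism phi -> star_morphism psi -> cstar_generated G = setT ->
  (forall x, G x -> phi x = psi x) -> phi = psi.
Proof.
move=> mphi mpsi gen h; apply/funext => x.
have gx : cstar_generated G x by rewrite gen.
by apply: (gx [set y | phi y = psi y]); split => //; exact: cstar_subalgebra_eq.
Qed.

End StarMorphismEquality.

(** * Projections with sum 1 are pairwise orthogonal *)

Section OrthogonalProjections.
Variables (R : realType) (A : cstarAlgType R).
Implicit Types (p q x y z : A) (s : R).

(* Both [q + z] and [q - z] are squares up to [1 - s], of commuting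
   self-adjoint elements whose squares add up to [2 (1 - s) q]. *)
Lemma corner_ball_eq0 q z : star q = q -> q * q = q ->
  star z = z -> q * z = z -> z * q = z ->
  cnorm (q - z) <= 1 -> cnorm (q + z) <= 1 -> z = 0.
Proof.
move=> sq qq sz qz zq h1 h2.
(* Scaling by [s < 1] puts [q - z] and [q + z] in the open unit ball, as [sqrt_fixpoint] requires.
   The constant 3 is 2 + 1: [s z] is [q - w1], of norm at most [2 (1 - s)], minus [(1 - s) q]. *)
have key s : 0 < s -> s < 1 -> s * cnorm z <= 3 * (1 - s).
  move=> s0 s1; have sge0 := ltW s0.
  set w1 := s%:C%C *: (q - z); set w2 := s%:C%C *: (q + z).
  have n1 : cnorm w1 < 1.
    by rewrite cnormZr// (le_lt_trans _ s1)// ler_piMr.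
  have n2 : cnorm w2 < 1.
    by rewrite cnormZr// (le_lt_trans _ s1)// ler_piMr.
  have sw1 : star w1 = w1 by rewrite starZ conjc_real starB sq sz.
  have sw2 : star w2 = w2 by rewrite starZ conjc_real starD sq sz.
  have cw1 : q * w1 = w1 /\ w1 * q = w1.
    by rewrite -scalerAr -scalerAl mulrBr mulrBl qq qz zq.
  have cw2 : q * w2 = w2 /\ w2 * q = w2.
    by rewrite -scalerAr -scalerAl mulrDr mulrDl qq qz zq.
  have w21 : w2 * w1 = w1 * w2.
    rewrite -!scalerAl -!scalerAr mulrDl !mulrBr !mulrBl !mulrDr.
    by rewrite qq qz zq opprD !addrA subrK addrK.
  have q00 : q * 0 = 0 /\ 0 * q = 0 by rewrite mulr0 mul0r.
  have [y1 [e1 K1]] := sqrt_fixpoint n1.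
  have [y2 [e2 K2]] := sqrt_fixpoint n2.
  have sy1 : star y1 = y1.
    apply: (K1 [set x : A | star x = x]); [exact: closed_sa|exact: star0|].
    by move=> x xK; exact: step_sa.
  have sy2 : star y2 = y2.
    apply: (K2 [set x : A | star x = x]); [exact: closed_sa|exact: star0|].
    by move=> x xK; exact: step_sa.
  have cy1 : q * y1 = y1 /\ y1 * q = y1.
    apply: (K1 [set x | q * x = x /\ x * q = x]) => //.
      exact: closed_corner.
    by move=> x; exact: step_corner.
  have cy2 : q * y2 = y2 /\ y2 * q = y2.
    apply: (K2 [set x | q * x = x /\ x * q = x]) => //.
      exact: closed_corner.
    by move=> x; exact: step_corner.
  (* Commutation of [w1] and [w2] spreads in two stages: first to [y1] and [w2], then to [y1] and
     [y2]. *)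
  have wy : w2 * y1 = y1 * w2.
    apply: (K1 [set x | w2 * x = x * w2]); first exact: closed_commute.
      by rewrite /= mulr0 mul0r.
    by move=> x; exact: step_commute.
  have yy : y1 * y2 = y2 * y1.
    apply: (K2 [set x | y1 * x = x * y1]); first exact: closed_commute.
      by rewrite /= mulr0 mul0r.
    by move=> x; apply: step_commute.
  have d1 := corner_sub_sqr qq cy1 e1; have d2 := corner_sub_sqr qq cy2 e2.
  have : cnorm (q - w1) <= cnorm (q - w1 + (q - w2)).
    rewrite -d1 -d2; apply: cnorm_sa_le; rewrite ?starB ?sq ?sy1 ?sy2//.
    have [qy1 y1q] := cy1; have [qy2 y2q] := cy2.
    rewrite !mulrBr !mulrBl qq qy1 y1q qy2 y2q yy !opprB -!addrA.
    by congr (_ + _); rewrite addrCA [RHS]addrCA [- y2 + _]addrC.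
  have -> : q - w1 + (q - w2) = (2 * (1 - s))%:C%C *: q.
    rewrite addrACA -opprD -scalerDr addrACA addNr addr0 -!mulr2n.
    rewrite -[q *+ 2]scaler_nat scalerA -scalerBl; congr (_ *: _).
    by apply/eqP; rewrite eq_complex/=; apply/andP; split; apply/eqP; ring.
  have s10 : 0 <= 1 - s by rewrite subr_ge0 ltW.
  rewrite cnormZr ?mulr_ge0// => hle.
  have e3 : s%:C%C *: z = (q - w1) - (1 - s)%:C%C *: q.
    rewrite rmorphB rmorph1 scalerBl scale1r /w1 scalerBr !opprB addrA.
    by rewrite /= addrA subrK addrAC subrr add0r.
  have := cnormB (q - w1) ((1 - s)%:C%C *: q); rewrite -e3 !cnormZr//.
  have := cnorm_idem_le1 sq qq; have := cnorm_ge0 q.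
  set t := cnorm q in hle *.
  nra.
apply: cnorm_eq0; apply/eqP; rewrite eq_le cnorm_ge0 andbT leNgt.
apply/negP => t0; set t := cnorm z in key t0.
(* At [s = 1 - d] the bound [key] reads [t <= d * (3 + t)], and this [d] makes the right-hand side
   [t / 2]. *)
have d0 : 0 < t / (2 * (3 + t)) by rewrite divr_gt0// mulr_gt0// addr_gt0.
have d1 : t / (2 * (3 + t)) * (2 * (3 + t)) = t.
  by rewrite divfK// mulf_neq0 ?pnatr_eq0// gt_eqF// addr_gt0.
have d2 : t / (2 * (3 + t)) < 1.
  by rewrite ltr_pdivrMr ?mulr_gt0 ?addr_gt0// mul1r; lra.
have := key (1 - t / (2 * (3 + t))); move: d0 d1 d2; set d := t / _ => d0 d1 d2.
have dt : 0 < d * t by rewrite mulr_gt0.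
have h3 : 0 < 1 - d by rewrite subr_gt0.
have h4 : 1 - d < 1 by rewrite gtrBl.
move=> /(_ h3 h4); nra.
Qed.

(** Each reflection [1 - 2 p k] is unitary, so its compression [q - 2 q p_k q] by [q = p i] has norm
    at most 1. The [q p_k q] with [k != i] add up to 0, so [x = q p_j q] is minus the sum of the
    others. Averaging compressions with copies of [q] then puts both [q + (2/t) x] and [q - (2/t) x]
    in the unit ball, and [corner_ball_eq0] applies. *)
Lemma sum_projections_orthogonal (I : finType) (p : I -> A) (i j : I) :
  (forall k, star (p k) = p k) -> (forall k, p k * p k = p k) ->
  1 = \sum_k p k -> i != j -> p i * p j = 0.
Proof.
move=> sp pp p1 ij; set q := p i.
have q1 : cnorm q <= 1 by apply: cnorm_idem_le1; rewrite ?sp ?pp.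
have reflection k : cnorm (q * (1 - p k *+ 2) * q) <= 1.
  have u1 : cnorm (1 - p k *+ 2) <= 1.
    apply: cnorm_unitary_le => //; rewrite expr1n scale1r.
    rewrite starB star1 mulr2n starD sp -mulr2n mulrBr mulr1 mulrBl mul1r.
    by rewrite mulrnAl mulrnAr pp opprB (mulr2n (p k *+ 2)) addrK subrK.
  rewrite (le_trans (cnormM _ _))// mulr_ile1 ?cnorm_ge0//.
  by rewrite (le_trans (cnormM _ _))// mulr_ile1 ?cnorm_ge0.
have reflectionE k : q * (1 - p k *+ 2) * q = q - (q * p k * q) *+ 2.
  by rewrite mulrBr mulr1 mulrBl pp mulrnAr mulrnAl.
have sum0 : \sum_(k | k != i) q * p k * q = 0.
  have : \sum_k q * p k * q = q by rewrite -mulr_suml -mulr_sumr -p1 mulr1 pp.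
  rewrite (bigD1 i)//= -/q; have -> : q * q * q = q by rewrite !pp.
  by move=> /(canRL (addKr _)) ->; rewrite addNr.
set x := q * p j * q; set P := [pred k | (k != i) && (k != j)].
have sumx : \sum_(k | P k) q * p k * q = - x.
  by apply: (addrI x); rewrite subrr -[RHS]sum0 [RHS](bigD1 j)//= eq_sym.
(* [t] is the number of terms in each average: [#|P|] copies of [q] and the reflection of [j], or
   the [#|P|] other reflections and one [q]. *)
have t0 : 0 < (#|P|%:R + 1 : R) by rewrite ltr_wpDl.
set t : R := #|P|%:R + 1 in t0.
have tE : t%:C%C = #|P|%:R + 1 by rewrite rmorphD rmorph1 rmorph_nat.
have z0 : (2 / t)%:C%C *: x = 0.
  have tq (y : A) : cnorm (q *+ #|P| + q + y) <= t ->
      cnorm (q + (t^-1)%:C%C *: y) <= 1.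
    have -> : q + (t^-1)%:C%C *: y = (t^-1)%:C%C *: (q *+ #|P| + q + y).
      rewrite scalerDr; congr (_ + _); rewrite -[q in _ + q]scale1r -scaler_nat.
      by rewrite -scalerDl scalerA -tE -rmorphM mulVf ?gt_eqF// scale1r.
    by rewrite cnormZr ?ler_pdivrMl ?mulr1// invr_ge0 ltW.
  have x2 : (2 / t)%:C%C *: x = (t^-1)%:C%C *: (x *+ 2).
    rewrite -[x *+ 2]scaler_nat scalerA; congr (_ *: _).
    by rewrite mulrC rmorphM rmorph_nat.
  have sx : star x = x by rewrite !starM !sp mulrA.
  apply: (@corner_ball_eq0 q) => //.
  - exact: sp.
  - exact: pp.
  - by rewrite starZ conjc_real sx.
  - by rewrite -scalerAr /x !mulrA !pp.
  - by rewrite -scalerAl /x -!mulrA !pp.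
  - rewrite x2 -scalerN; apply: tq; rewrite -addrA -reflectionE.
    rewrite (le_trans (cnormD _ _))// lerD// -sumr_const.
    rewrite (le_trans (cnorm_sum _ _ _))// -sumr_const ler_sum//.
  - rewrite x2; apply: tq; rewrite addrAC.
    have -> : q *+ #|P| + x *+ 2 = \sum_(k | P k) q * (1 - p k *+ 2) * q.
      under eq_bigr do rewrite reflectionE.
      by rewrite sumrB sumr_const sumrMnl sumx mulNrn opprK.
    rewrite (le_trans (cnormD _ _))// lerD//.
    by rewrite (le_trans (cnorm_sum _ _ _))// -sumr_const ler_sum//.
have {z0}x0 : x = 0.
  have t2 : t / 2 * (2 / t) = 1 by field; rewrite gt_eqF.
  by rewrite -[x]scale1r -(rmorph1 (real_complex R)) -t2 rmorphM -scalerA z0 scaler0.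
(* [x] is the product of [star (p j * q)] and [p j * q]. *)
have pq : p j * q = 0.
  by apply: starMx_eq0; rewrite starM !sp mulrA -(mulrA q) pp.
by rewrite -(starK (_ * _)) starM !sp pq star0.
Qed.

End OrthogonalProjections.

(** * Linear combinations of orthogonal projections with sum 1 *)

Section DiagonalSums.
Variables (R : realType) (O : cstarAlgType R) (I : finType) (e : I -> O).
Hypothesis e_sa : forall i, star (e i) = e i.
Hypothesis eM : forall i j, e i * e j = if i == j then e i else 0.
Hypothesis e1 : \sum_i e i = 1.
Implicit Types c d : I -> R[i].

Definition diag c : O := \sum_i c i *: e i.

Lemma diagM c d : diag c * diag d = diag (fun i => c i * d i).
Proof.
rewrite /diag mulr_suml; apply: eq_bigr => i _.
rewrite mulr_sumr (bigD1 i)//= big1 ?addr0.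
  by rewrite -scalerAl -scalerAr eM eqxx scalerA.
move=> j ji; rewrite -scalerAl -scalerAr eM eq_sym (negbTE ji).
by rewrite !scaler0.
Qed.

Lemma diagP (a : R[i]) c d : diag (fun i => a * c i + d i) = a *: diag c + diag d.
Proof.
rewrite /diag scaler_sumr -big_split; apply: eq_bigr => i _ /=.
by rewrite scalerA scalerDl.
Qed.

Lemma diag_star c : star (diag c) = diag (fun i => (c i)^*%C).
Proof. by rewrite /diag star_sum; apply: eq_bigr => i _; rewrite starZ e_sa. Qed.

Lemma diag_const (a : R[i]) : diag (fun=> a) = a%:A.
Proof. by rewrite /diag -scaler_sumr e1. Qed.

Lemma diag_eigen c i : e i * diag c = c i *: e i.
Proof.
rewrite /diag mulr_sumr (bigD1 i)//= -scalerAr eM eqxx big1 ?addr0// => j ji.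
by rewrite -scalerAr eM eq_sym (negbTE ji) scaler0.
Qed.

(** Multiplication by [e i] isolates the coefficient [c i], and a nonzero projection has norm 1. *)
Lemma diag_norm_ge c i : e i != 0 -> cabs (c i) <= cnorm (diag c).
Proof.
move=> ei; have ni : cnorm (e i) = 1.
  by apply: cnorm_idem_sa => //; rewrite eM eqxx.
have := cnormM (e i) (diag c).
by rewrite diag_eigen cnormZE ni mulr1 mul1r.
Qed.

(* A real number of modulus at most [m] is the real part of a complex number
   of modulus [m]. *)
Lemma diag_norm_le c m : 0 <= m -> (forall i, cabs (c i) <= m) ->
  cnorm (diag c) <= m.
Proof.
move=> m0 cm.
pose b i : R[i] := (Num.sqrt (m ^+ 2 - cabs (c i) ^+ 2))%:C%C.
pose a i : R[i] := (cabs (c i))%:C%C.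
have sa : star (diag a) = diag a.
  by rewrite diag_star; congr diag; apply/funext => i; rewrite conjc_real.
have sb : star (diag b) = diag b.
  by rewrite diag_star; congr diag; apply/funext => i; rewrite conjc_real.
have ab : diag a * diag b = diag b * diag a.
  by rewrite !diagM; congr diag; apply/funext => i; rewrite mulrC.
have le_a : cnorm (diag a) <= m.
  apply: le_trans (cnorm_le_add_im sa sb) _; apply: cnorm_unitary_le => //.
  rewrite star_add_im// mul_star_add_im// !diagM -diag_const /diag -big_split/=.
  apply: eq_bigr => i _; rewrite -scalerDl; congr (_ *: _).
  rewrite -!rmorphM -rmorphD/= -!expr2 sqr_sqrtr ?subrKC//.
  by rewrite subr_ge0 ler_pXn2r ?nnegrE ?cabs_ge0.
(* By the C*-identity, [c] may be replaced by its modulus [a], to which [le_a] applies. *)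
rewrite -(@ler_pXn2r _ 2) ?nnegrE ?cnorm_ge0// -cnorm_starM.
have -> : star (diag c) * diag c = star (diag a) * diag a.
  rewrite sa diag_star !diagM; congr diag; apply/funext => i.
  by rewrite mulcJ rmorphXn expr2.
by rewrite cnorm_starM ler_pXn2r ?nnegrE ?cnorm_ge0.
Qed.

End DiagonalSums.

(** * Relations between generators and word projections *)

Lemma big_tuple_cons (V : nmodType) (T : finType) n (F : seq T -> V) :
  \sum_(t : n.+1.-tuple T) F t = \sum_i \sum_(t : n.-tuple T) F (i :: t).
Proof.
rewrite pair_big/= (reindex (fun p : T * n.-tuple T => [tuple of p.1 :: p.2]))//=.
exists (fun t => (thead t, [tuple of behead t])) => [[i t] _|t _] /=.
  by congr (_, _); apply: val_inj.
by rewrite [RHS]tuple_eta.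
Qed.

Section CKRelations.
Variables (R : realType) (N : nat) (A : 'M[nat]_N).
Variables (O : cstarAlgType R) (S : 'I_N -> O).
Hypotheses (A01 : zero_one_matrix A) (ckS : ck_family A S).
Implicit Types (i j : 'I_N) (mu nu : seq 'I_N).

Lemma ck_pi i : S i * star (S i) * S i = S i.
Proof. by have [h _ _] := ckS; exact: h. Qed.

Lemma ck_pi_star i : star (S i) * S i * star (S i) = star (S i).
Proof. by rewrite -[RHS](congr1 _ (ck_pi i)) !starM starK mulrA. Qed.

Lemma ck_sum : \sum_j S j * star (S j) = 1.
Proof. by have [_ -> _] := ckS. Qed.

(** The relations prescribe only the sum of the range projections; [sum_projections_orthogonal]
    makes these orthogonal, and inserting them between [star (S i)] and [S j] concludes. *)
Lemma ck_orthogonal i j : i != j -> star (S i) * S j = 0.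
Proof.
move=> ij; have -> : star (S i) * S j =
    star (S i) * (S i * star (S i) * (S j * star (S j))) * S j.
  by rewrite !mulrA ck_pi_star -!mulrA (mulrA (S j)) ck_pi.
rewrite (sum_projections_orthogonal (p := fun k => S k * star (S k)))//.
- by rewrite mulr0 mul0r.
- by move=> k; rewrite starM starK.
- by move=> k; rewrite mulrA ck_pi.
- exact/esym/ck_sum.
Qed.

Lemma ck_initial i j : star (S i) * S i * S j = S j *+ A i j.
Proof.
have [_ _ ->] := ckS; rewrite mulr_suml (bigD1 j)//= mulrnAl ck_pi.
rewrite big1 ?addr0// => k kj; rewrite mulrnAl -mulrA ck_orthogonal//.
by rewrite mulr0 mul0rn.
Qed.

Lemma ck_inadmissible i j : A i j = 0%N -> S i * S j = 0.
Proof. by move=> ij; rewrite -ck_pi -!mulrA (mulrA (star _)) ck_initial ij mulr0. Qed.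

Local Notation P := (word_projection S).

Lemma word_projection_nil : P [::] = 1.
Proof. by rewrite /word_projection big_nil star1 mulr1. Qed.

Lemma word_projection_cons i mu : P (i :: mu) = S i * P mu * star (S i).
Proof. by rewrite /word_projection big_cons starM !mulrA. Qed.

Lemma word_projection_sa mu : star (P mu) = P mu.
Proof. by rewrite /word_projection starM starK. Qed.

Lemma ck_initial_word i j mu :
  star (S i) * S i * P (j :: mu) = P (j :: mu) *+ A i j.
Proof. by rewrite word_projection_cons !mulrA ck_initial !mulrnAl. Qed.

Lemma ck_initial_sa i : star (star (S i) * S i) = star (S i) * S i.
Proof. by rewrite starM starK. Qed.

(** For a nonempty word the product is a natural multiple of [P mu], hence self-adjoint, and taking
    adjoints exchanges the factors. *)
Lemma ck_initial_comm i mu :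
  star (S i) * S i * P mu = P mu * (star (S i) * S i).
Proof.
case: mu => [|j mu]; first by rewrite word_projection_nil mulr1 mul1r.
rewrite -[RHS]starK starM ck_initial_sa word_projection_sa ck_initial_word.
by rewrite -scaler_nat starZ conjc_nat word_projection_sa.
Qed.

Lemma word_projection_consM i mu nu :
  P (i :: mu) * P (i :: nu) = S i * (P mu * P nu) * star (S i).
Proof.
transitivity (S i * (P mu * (star (S i) * S i)) * P nu * star (S i)).
  by rewrite !word_projection_cons !mulrA.
by rewrite -ck_initial_comm !mulrA ck_pi.
Qed.

Lemma word_projectionM mu nu : size mu = size nu ->
  P mu * P nu = if mu == nu then P mu else 0.
Proof.
elim: mu nu => [|i mu ih] [|j nu]//= => [_|[sz]].
  by rewrite word_projection_nil mulr1.
rewrite eqseq_cons; have [<-|ij] /= := eqVneq i j.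
  rewrite word_projection_consM ih//; case: eqP => // _.
    by rewrite word_projection_cons.
  by rewrite mulr0 mul0r.
transitivity (S i * P mu * (star (S i) * S j) * P nu * star (S j)).
  by rewrite !word_projection_cons !mulrA.
by rewrite ck_orthogonal// mulr0 !mul0r.
Qed.

Lemma word_projection_sum n : \sum_(mu : n.-tuple 'I_N) P mu = 1.
Proof.
elim: n => [|n ih].
  by rewrite (big_pred1 [tuple]) ?word_projection_nil// => t; rewrite [t]tuple0 /= eqxx.
rewrite big_tuple_cons -ck_sum; apply: eq_bigr => i _.
under eq_bigr do rewrite word_projection_cons.
by rewrite -mulr_suml -mulr_sumr ih mulr1.
Qed.

Lemma word_projection_split mu n :
  \sum_(nu : n.-tuple 'I_N) P (mu ++ nu) = P mu.
Proof.
elim: mu => [|i mu ih]; first by rewrite word_projection_sum word_projection_nil.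
under eq_bigr do rewrite /= word_projection_cons.
by rewrite -mulr_suml -mulr_sumr ih word_projection_cons.
Qed.

End CKRelations.

(** * Prefix neighbourhoods, compactness and continuity on the shift space *)

Section ShiftTopology.
Variable N : nat.
Implicit Types f g : full_shift N.

Lemma nbhs_full_shift_agree f n :
  nbhs f [set g | forall k, (k < n)%N -> g k = f k].
Proof.
elim: n => [|n ih]; first by apply: filterS filterT => g _ k.
have h : nbhs f [set g : full_shift N | g n = f n].
  by apply: (@proj_continuous _ (fun=> discrete_topology 'I_N) n f [set f n]);
    exact: discrete_set1.
apply: filterS (filterI ih h) => g [/= h1 h2] k.
by rewrite ltnS leq_eqVlt => /predU1P[->//|]; exact: h1.
Qed.

(** The filter generated by the prefix sets converges to [f] in each coordinate, hence in the
    product topology. *)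
Lemma nbhs_full_shiftP f (U : set (full_shift N)) : nbhs f U ->
  exists n, forall g : full_shift N, (forall k, (k < n)%N -> g k = f k) -> U g.
Proof.
move=> fU.
pose B n := [set g : full_shift N | forall k, (k < n)%N -> g k = f k].
pose F := filter_from [set: nat] B.
have FF : Filter F.
  apply: filter_from_filter; first by exists 0%N.
  move=> i j _ _; exists (maxn i j) => // g gB.
  by split=> k kn; apply: gB; rewrite leq_max kn ?orbT.
have Ff : F --> f.
  apply/cvg_sup => n V [W [[W' oW <-] Wf WV]]; exists n.+1 => // g gB.
  by apply: WV; rewrite /= gB.
by have [n _ h] := Ff _ fU; exists n => g gB; exact: h.
Qed.

End ShiftTopology.

Section MarkovTopology.
Variables (N : nat) (A : 'M[nat]_N).
Local Notation X := (markov_space A).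
Implicit Types (x y : X) (mu : seq 'I_N).

Definition agree n x y := forall k, (k < n)%N -> set_val x k = set_val y k.

Lemma agree_trans n y x z : agree n x y -> agree n y z -> agree n x z.
Proof. by move=> h h' k kn; rewrite h// h'. Qed.

Lemma agree_le m n x y : (m <= n)%N -> agree n x y -> agree m x y.
Proof. by move=> mn h k km; apply: h; exact: leq_trans mn. Qed.

Lemma markov_ext x y : (forall n, set_val x n = set_val y n) -> x = y.
Proof. by move=> h; apply: val_inj; apply/funext. Qed.

Lemma markovP x n : A (set_val x n) (set_val x n.+1) = 1%N.
Proof. by have /set_mem := valP x; apply. Qed.

Lemma markov_shiftE x n : set_val (markov_shift x) n = set_val x n.+1.
Proof. by []. Qed.

Lemma nbhs_agree x n : nbhs x [set y | agree n y x].
Proof.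
exact: (@initial_continuous _ _ (@set_val _ (markov_seq A)) x _
  (nbhs_full_shift_agree (set_val x) n)).
Qed.

Lemma nbhs_markovP x (U : set X) :
  nbhs x U -> exists n, forall y, agree n y x -> U y.
Proof.
rewrite nbhsE => -[_ [[V oV <-] /= Vx] VU].
have [n hn] := nbhs_full_shiftP (open_nbhs_nbhs (conj oV Vx)).
by exists n => y xy; apply: VU; exact: hn.
Qed.

Lemma compact_markov_seq : compact (markov_seq A).
Proof.
apply: (subclosed_compact (B := setT)) => //.
  (* Admissibility at position [n] involves letters [n] and [n.+1], so a prefix of length [n.+2]
     decides it. *)
  move=> f fA n; have [g [gA gf]] := fA _ (nbhs_full_shift_agree f n.+2).
  by rewrite -gf// -gf.
have := @tychonoff nat (fun=> discrete_topology 'I_N) (fun=> setT).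
have -> : [set f | forall i : nat, [set: discrete_topology 'I_N] (f i)] = setT.
  by rewrite predeqE.
by apply=> _; apply: finite_compact; exact: finite_finset.
Qed.

(** A Lebesgue-number argument: by compactness, thresholds that depend on the point but hold on a
    neighbourhood and for all larger lengths yield a single one. *)
Lemma uniform_prefix (G : nat -> X -> Prop) :
  (forall x, exists n, forall m y, (n <= m)%N -> agree n y x -> G m y) ->
  exists n, forall x, G n x.
Proof.
move=> h.
have /compact_near_coveringP := compact_markov_seq.
move=> /(_ nat \oo (fun m f => forall y : X, set_val y = f -> G m y)).
case=> [f fA|n _ hn]; last first.
  by exists n => x; apply: (hn n) => //=; exact: set_mem (valP x).
have [n hn] := h (exist _ f (mem_set fA)).
exists ([set g | forall k, (k < n)%N -> g k = f k], [set m | (n <= m)%N]).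
  by split; [exact: nbhs_full_shift_agree|exists n].
move=> [g m] /= [gf nm] y yg; apply: hn => // k kn.
by rewrite yg gf.
Qed.

Variable R : realType.

Lemma continuousC (f : X -> R[i]) : Cspace f <->
  forall x (e : R), 0 < e -> exists n, forall y, agree n y x ->
    cabs (f x - f y) < e.
Proof.
split=> [cf x e e0|h x].
  have /cvgrPdist_lt/(_ e%:C%C) := cf x; rewrite ltcR => /(_ e0) /nbhs_markovP[n hn].
  by exists n => y yx; rewrite -ltcR -cabsE; exact: hn.
apply/(cvgrPdist_lt (FF := nbhs_filter x)) => e e0.
have [e' ee] : exists e', e = e'%:C%C.
  by exists (complex.Re e); rewrite RRe_real// gtr0_real.
move: e0; rewrite ee ltcR => e0; have [n hn] := h x _ e0.
by apply: filterS (nbhs_agree x n) => y yx; rewrite cabsE ltcR; exact: hn.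
Qed.

(** Uniform continuity on a compact space: the prefix length depends on [e] only. *)
Lemma CspaceP (f : X -> R[i]) : Cspace f <->
  forall e : R, 0 < e -> exists n, forall x y, agree n y x ->
    cabs (f x - f y) < e.
Proof.
split=> [/continuousC cf e e0|h]; last first.
  by apply/continuousC => x e /h[n hn]; exists n => y; exact: hn.
have e20 : 0 < e / 2 by rewrite divr_gt0.
apply: (uniform_prefix (G := fun m x => forall y, agree m y x ->
  cabs (f x - f y) < e)) => x.
have [n hn] := cf x _ e20; exists n => m y nm yx z zy.
have -> : f y - f z = f x - f z - (f x - f y) by ring.
have := hn y yx; have := hn z (agree_trans (agree_le nm zy) yx).
have := cabsD (f x - f z) (- (f x - f y)); rewrite cabsN.
lra.
Qed.

Lemma Cspace_locally_constant (f : X -> R[i]) n :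
  (forall x y, agree n x y -> f x = f y) -> Cspace f.
Proof.
move=> h; apply/CspaceP => e e0; exists n => x y yx.
by rewrite (h _ _ yx) subrr cabs0.
Qed.

Lemma Cspace_cst (c : R[i]) : Cspace (fun _ : X => c).
Proof. by apply: (@Cspace_locally_constant _ 0%N). Qed.

Lemma CspaceM (f g : X -> R[i]) : Cspace f -> Cspace g ->
  Cspace (fun x => f x * g x).
Proof. by move=> cf cg x; exact: (cvgM (cf x) (cg x)). Qed.

Lemma CspaceD (f g : X -> R[i]) : Cspace f -> Cspace g ->
  Cspace (fun x => f x + g x).
Proof. by move=> cf cg x; exact: (cvgD (cf x) (cg x)). Qed.

Lemma CspaceZD (c : R[i]) (f g : X -> R[i]) : Cspace f -> Cspace g ->
  Cspace (fun x => c * f x + g x).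
Proof.
by move=> cf cg; exact (@CspaceD _ _ (@CspaceM _ _ (@Cspace_cst c) cf) cg).
Qed.

Lemma CspaceB (f g : X -> R[i]) : Cspace f -> Cspace g ->
  Cspace (fun x => f x - g x).
Proof. by move=> cf cg x; exact: (cvgB (cf x) (cg x)). Qed.

Lemma CspaceV (f : X -> R[i]) : (forall x, f x != 0) -> Cspace f ->
  Cspace (fun x => (f x)^-1).
Proof. by move=> f0 cf x; exact: (cvgV (f0 x) (cf x)). Qed.

Local Opaque Cspace.

Lemma Cspace_conj (f : X -> R[i]) : Cspace f -> Cspace (fun x => (f x)^*%C).
Proof.
move=> /CspaceP cf; apply/CspaceP => e /cf[n hn]; exists n => x y yx.
by rewrite -rmorphB/= cabs_conj hn.
Qed.

Lemma Cspace_sum (I : Type) (s : seq I) (F : I -> X -> R[i]) :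
  (forall i, Cspace (F i)) -> Cspace (fun x => \sum_(i <- s) F i x).
Proof.
move=> cF; elim: s => [|i s ih].
  under eq_fun do rewrite big_nil.
  exact (@Cspace_cst 0).
under eq_fun do rewrite big_cons.
exact (@CspaceD _ _ (cF i) ih).
Qed.

(** A tuple, so that the words of a given length form a finite type to sum over. *)
Definition initial_word n x : n.-tuple 'I_N := [tuple of mkseq (set_val x) n].

Lemma initial_wordP n x y : initial_word n x = initial_word n y <-> agree n x y.
Proof.
split=> [/(congr1 val)/= h k kn|h].
  by rewrite -(nth_mkseq (set_val x 0%N) (set_val x) kn) h nth_mkseq.
by apply: val_inj => /=; apply/eq_in_map => k; rewrite mem_iota; exact: h.
Qed.

Lemma cylinder_initial_word n (t : n.-tuple 'I_N) x : cylinder t x <-> initial_word n x = t.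
Proof.
rewrite /cylinder /= size_tuple; split=> [h|/(congr1 val)//].
exact: val_inj.
Qed.

Lemma mkseq_cons (T : Type) (f : nat -> T) n :
  mkseq f n.+1 = f 0%N :: mkseq (fun k => f k.+1) n.
Proof. by rewrite /mkseq /= -[1%N]addn0 iotaDl -map_comp. Qed.

Lemma cylinder_cons i mu x :
  cylinder (i :: mu) x <-> set_val x 0%N = i /\ cylinder mu (markov_shift x).
Proof.
rewrite /cylinder /= mkseq_cons; split=> [[-> h]|[-> h]].
  by split=> //; rewrite -[RHS]h.
by congr (_ :: _); rewrite -[RHS]h.
Qed.

(** Convertible to the indicator in [canonical_identification], to which facts about [chi] therefore
    apply. *)
Definition chi mu x : R[i] := \1_(cylinder mu : set X) x.

Lemma chi_initial_word n (t : n.-tuple 'I_N) x : chi t x = (initial_word n x == t)%:R.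
Proof.
rewrite /chi /indic; congr (_%:R); congr nat_of_bool.
apply/idP/eqP => [/set_mem/cylinder_initial_word//|/cylinder_initial_word h].
exact/mem_set.
Qed.

Lemma chi_cons i mu x :
  chi (i :: mu) x = chi [:: i] x * chi mu (markov_shift x).
Proof.
rewrite /chi /indic -natrM mulnb; congr (_%:R); congr nat_of_bool.
apply/idP/andP => [/set_mem/cylinder_cons[xi xmu]|[/set_mem xi /set_mem xmu]].
  by split; apply/mem_set => //; apply/cylinder_cons.
by apply/mem_set/cylinder_cons; split=> //; case/cylinder_cons: xi.
Qed.

Lemma chi1 i x : chi [:: i] x = (set_val x 0%N == i)%:R.
Proof.
rewrite /chi /indic; congr (_%:R); congr nat_of_bool.
by apply/idP/eqP => [/set_mem/cylinder_cons[]//|h]; apply/mem_set/cylinder_cons.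
Qed.

Lemma Cspace_chi mu : Cspace (chi mu).
Proof.
apply: (@Cspace_locally_constant _ (size mu)) => x y /initial_wordP h.
by rewrite -[mu]/(val (in_tuple mu)) !chi_initial_word h.
Qed.

Lemma agree_shift n x y :
  agree n.+1 x y -> agree n (markov_shift x) (markov_shift y).
Proof. by move=> h k kn; exact: h. Qed.

Lemma Cspace_shift (f : X -> R[i]) : Cspace f -> Cspace (f \o @markov_shift N A).
Proof.
move=> /CspaceP cf; apply/CspaceP => e /cf[n hn]; exists n.+1 => x y yx.
by apply: hn; exact: agree_shift.
Qed.

Lemma markov_cons_ext x y : set_val x 0%N = set_val y 0%N ->
  markov_shift x = markov_shift y -> x = y.
Proof.
move=> h0 h; apply: markov_ext => -[//|n].
exact: (congr1 (fun z : X => set_val z n) h).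
Qed.

Lemma markov_cons i x : A i (set_val x 0%N) = 1%N ->
  exists2 y, set_val y 0%N = i & markov_shift y = x.
Proof.
move=> h; pose s : full_shift N := fun n => if n is m.+1 then set_val x m else i.
have sA : s \in markov_seq A by apply/mem_set => -[//|n]; exact: markovP.
by exists (exist _ s sA) => //; apply: markov_ext.
Qed.

(** A continuous integer-valued function is locally constant, and so is any function of it. *)
Lemma Cspace_int_comp (g : X -> int) (F : int -> R[i]) :
  Cspace_int g -> Cspace (F \o g).
Proof.
move=> cg; apply/continuousC => x e e0.
have /nbhs_markovP[n hn] : nbhs x [set y | g y = g x].
  exact: (cg x [set g x] (@discrete_set1 (discrete_topology int) (g x))).
by exists n => y yx /=; rewrite (hn y yx) subrr cabs0.
Qed.

Lemma Cspace_int_locally_constant (g : X -> int) n :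
  (forall x y, agree n x y -> g x = g y) -> Cspace_int g.
Proof.
move=> h x U Ux; apply: filterS (nbhs_agree x n) => y yx /=.
by rewrite (h _ _ yx); exact: (nbhs_singleton Ux).
Qed.

End MarkovTopology.

Lemma Cspace_comp (R : realType) (N M : nat) (A : 'M[nat]_N) (B : 'M[nat]_M)
    (h : markov_space A -> markov_space B) (f : markov_space B -> R[i]) :
  continuous h -> Cspace f -> Cspace (f \o h).
Proof. by move=> ch cf x; apply: continuous_comp; [exact: ch|exact: cf]. Qed.

(* Otherwise unification unfolds [continuous] in every goal [Cspace f]. *)
Local Opaque Cspace.

(** * Limits in C*-algebras and in the complex numbers *)

Section Convergence.
Variables (R : realType) (O : cstarAlgType R).
Implicit Types (u v : nat -> O) (l : O).

Lemma converges_norm_le u l m n0 : converges u l ->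
  (forall n, (n0 <= n)%N -> cnorm (u n) <= m) -> cnorm l <= m.
Proof.
move=> ul um; apply/ler_addgt0Pr => e e0; have [n hn] := ul e e0.
have := um _ (leq_maxr n n0); have := hn _ (leq_maxl n n0).
have := cnorm_tri (u (maxn n n0)) l 0; rewrite !subr0 cnormC; lra.
Qed.

Lemma converges_le_norm u l m : converges u l ->
  (forall e, 0 < e -> exists n0, forall n, (n0 <= n)%N -> m - e <= cnorm (u n)) ->
  m <= cnorm l.
Proof.
move=> ul um; apply/ler_addgt0Pr => e e0.
have e20 : 0 < e / 2 by rewrite divr_gt0.
have [n hn] := ul _ e20; have [n0 hn0] := um _ e20.
have := hn0 _ (leq_maxr n n0); have := hn _ (leq_maxl n n0).
have := cnorm_tri l (u (maxn n n0)) 0; rewrite !subr0; lra.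
Qed.

Lemma converges_lin u v l l' (c : R[i]) : converges u l -> converges v l' ->
  converges (fun n => c *: u n + v n) (c *: l + l').
Proof.
move=> ul vl e e0; have c0 : 0 < cabs c + 1 by rewrite ltr_wpDl ?cabs_ge0.
have [n hn] := ul (e / 2 / (cabs c + 1)) (divr_gt0 (divr_gt0 e0 (ltr0n _ 2)) c0).
have [n' hn'] := vl (e / 2) (divr_gt0 e0 (ltr0n _ 2)).
exists (maxn n n') => p; rewrite geq_max => /andP[/hn + /hn'].
rewrite ltr_pdivlMr// => h h'.
have -> : c *: u p + v p - (c *: l + l') = c *: (u p - l) + (v p - l').
  by rewrite scalerBr opprD addrACA.
have := cnormD (c *: (u p - l)) (v p - l'); rewrite cnormZE.
have := cnorm_ge0 (u p - l); have := cabs_ge0 c.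
set a := cnorm (u p - l) in h *; set b := cabs c in h *; nra.
Qed.

Lemma converges_mul u v l l' : converges u l -> converges v l' ->
  converges (fun n => u n * v n) (l * l').
Proof.
move=> ul vl e e0; set k := cnorm l + cnorm l' + 1.
have k1 : 1 <= k by rewrite lerDr addr_ge0 ?cnorm_ge0.
have k0 : 0 < k by rewrite (lt_le_trans _ k1).
(* The minimum with 1 keeps [u p] within distance 1 of [l], which bounds its norm by [k]. *)
have d0 : 0 < Num.min 1 (e / (2 * k)) by rewrite lt_min ltr01 divr_gt0// mulr_gt0.
have [n hn] := ul _ d0; have [n' hn'] := vl _ d0.
exists (maxn n n') => p; rewrite geq_max => /andP[/hn + /hn'].
rewrite !lt_min !ltr_pdivlMr ?mulr_gt0// => /andP[h1 h] /andP[_ h'].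
have -> : u p * v p - l * l' = u p * (v p - l') + (u p - l) * l'.
  by rewrite mulrBr mulrBl addrA subrK.
have up : cnorm (u p) <= k.
  have := cnorm_tri l (u p) 0; rewrite !subr0; have := cnorm_ge0 l'; rewrite /k; lra.
have lk : cnorm l' <= k by rewrite /k; have := cnorm_ge0 l; lra.
have := cnormD (u p * (v p - l')) ((u p - l) * l').
have := cnormM (u p) (v p - l'); have := cnormM (u p - l) l'.
have := cnorm_ge0 (v p - l'); have := cnorm_ge0 (u p - l).
set a := cnorm (u p - l) in h h1 *; set b := cnorm (v p - l') in h' *.
move=> a0 b0; have : cnorm (u p) * b <= k * b by rewrite ler_wpM2r.
have : a * cnorm l' <= a * k by rewrite ler_wpM2l.
lra.
Qed.

Lemma converges_star u l : converges u l -> converges (fun n => star (u n)) (star l).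
Proof.
move=> ul e e0; have [n hn] := ul e e0; exists n => p np.
by rewrite -starB cnorm_star hn.
Qed.

Lemma converges_eventually u l n0 : (forall n, (n0 <= n)%N -> u n = l) ->
  converges u l.
Proof. by move=> h e e0; exists n0 => p np; rewrite h// subrr cnorm0. Qed.

Lemma cstar_generated_subalgebra (G : set O) : cstar_subalgebra (cstar_generated G).
Proof.
split.
- split=> [D [[[D0 _] _ _ _] _] //|c x y hx hy D [DS GD]].
  by have [[_ h] _ _ _] := DS; apply: h; [apply: hx|apply: hy].
- move=> x y hx hy D [DS GD].
  by have [_ h _ _] := DS; apply: h; [apply: hx|apply: hy].
- by move=> x hx D [DS GD]; have [_ _ h _] := DS; apply: h; apply: hx.
- move=> u l hu hl D [DS GD]; have [_ _ _ h] := DS.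
  by apply: (h u l) => // n; apply: hu.
Qed.

Lemma cstar_subalgebra_sum (D : set O) (I : Type) (s : seq I) (F : I -> O)
    (c : I -> R[i]) :
  cstar_subalgebra D -> (forall i, D (F i)) -> D (\sum_(i <- s) c i *: F i).
Proof.
move=> [[D0 DL] _ _ _] DF; elim: s => [|i s ih]; first by rewrite big_nil.
by rewrite big_cons; exact: DL.
Qed.

End Convergence.

Lemma complex_cauchy_converges (R : realType) (s : nat -> R[i]) :
  (forall e : R, 0 < e -> exists n, forall p q, (n <= p)%N -> (n <= q)%N ->
     cabs (s p - s q) < e) ->
  exists l, forall e : R, 0 < e -> exists n, forall p, (n <= p)%N ->
    cabs (s p - l) < e.
Proof.
move=> h.
have real (r : nat -> R) : (forall e : R, 0 < e -> exists n, forall p q,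
      (n <= p)%N -> (n <= q)%N -> `|r p - r q| < e) ->
    exists l, forall e : R, 0 < e -> exists n, forall p, (n <= p)%N -> `|r p - l| < e.
  move=> hr; have /cauchy_cvgP/cvg_ex[l /cvgrPdist_lt rl] : cauchy (r @ \oo).
    apply/cauchy_ballP => e e0; have [n hn] := hr e e0.
    exists (r @` [set k | (n <= k)%N], r @` [set k | (n <= k)%N]) => /=.
      by split; exists n => // k nk; exists k.
    by move=> [_ _] [/= [p np <-] [q nq <-]]; exact: hn.
  exists l => e e0; have [n _ hn] := rl e e0.
  by exists n => p np; rewrite distrC; exact: hn.
have [a ha] : exists l, forall e : R, 0 < e -> exists n, forall p, (n <= p)%N ->
    `|complex.Re (s p) - l| < e.
  apply: real => e /h[n hn]; exists n => p q np nq.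
  by rewrite (le_lt_trans _ (hn p q np nq))// -raddfB/= cabs_Re.
have [b hb] : exists l, forall e : R, 0 < e -> exists n, forall p, (n <= p)%N ->
    `|complex.Im (s p) - l| < e.
  apply: real => e /h[n hn]; exists n => p q np nq.
  by rewrite (le_lt_trans _ (hn p q np nq))// -raddfB/= cabs_Im.
exists (a +i* b)%C => e e0; have e20 : 0 < e / 2 by rewrite divr_gt0.
have [n hn] := ha _ e20; have [n' hn'] := hb _ e20.
exists (maxn n n') => p; rewrite geq_max => /andP[/hn + /hn'].
have := cabs_ReIm (s p - (a +i* b)%C); case: (s p) => x y /=; lra.
Qed.

(** * Nonzero generators and admissible words *)

Section Nonvanishing.
Variables (R : realType) (N : nat) (A : 'M[nat]_N).
Variables (O : cstarAlgType R) (S : 'I_N -> O).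
Hypotheses (A01 : zero_one_matrix A) (irrA : irreducible_matrix A).
Hypothesis ckS : ck_family A S.
Local Notation X := (markov_space A).
Local Notation P := (word_projection S).

Lemma mx_exprS_gt0 n i j : (0 < (A ^+ n.+1) i j)%N ->
  exists k, A i k = 1%N /\ (0 < (A ^+ n) k j)%N.
Proof.
rewrite exprS mxE => h; have [k] : exists k, (0 < A i k * (A ^+ n) k j)%N.
  apply/not_existsP => h'; move: h; rewrite big1// => k _.
  by apply/eqP; rewrite -leqn0 leqNgt; apply/negP; exact: h'.
rewrite muln_gt0 => /andP[Aik nkj]; exists k; split=> //.
by case: (A01 i k) Aik => ->.
Qed.

Lemma irreducible_row i : exists j, A i j = 1%N.
Proof.
have [[|n] [// _ h]] := irrA i i.
by have [k [Aik _]] := mx_exprS_gt0 h; exists k.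
Qed.

(** If [S i] vanished, its initial projection would too, hence also [S j] for each successor [j]; by
    irreducibility all generators would vanish, against their range projections adding up to 1. *)
Lemma ck_neq0 i : S i != 0.
Proof.
apply/eqP => Si; have step k j : S k = 0 -> A k j = 1%N -> S j = 0.
  move=> Sk Akj; have := ck_initial ckS k j.
  by rewrite Sk Akj mulr0 mul0r mulr1n => <-.
have S0 n : forall k j, S k = 0 -> (0 < (A ^+ n) k j)%N -> S j = 0.
  elim: n => [|n ih] k j Sk; last first.
    by move=> /mx_exprS_gt0[l [Akl lj]]; exact: ih (step _ _ Sk Akl) lj.
  by rewrite expr0 mxE; case: eqP => [<-|].
have := ck_sum ckS; rewrite big1 => [/esym/eqP|j _]; first by rewrite oner_eq0.
by have [n [_ nij]] := irrA i j; rewrite (S0 n i j)// mul0r.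
Qed.

Lemma markov_point i : exists x : X, set_val x 0%N = i.
Proof.
pose f k := projT1 (cid (irreducible_row k)).
have fP k : A k (f k) = 1%N := projT2 (cid (irreducible_row k)).
pose s : full_shift N := fun n => iter n f i.
have sA : s \in markov_seq A by apply/mem_set => n; exact: fP.
by exists (exist _ s sA).
Qed.

(** An empty alphabet would turn the sum relation into [1 = 0]. *)
Lemma markov_nonempty : exists x : X, True.
Proof.
case: (pickP (predT : pred 'I_N)) => [i _|no].
  by have [x _] := markov_point i; exists x.
have := ck_sum ckS; rewrite big1 => [/esym/eqP|j _]; first by rewrite oner_eq0.
by have := no j.
Qed.

(** Reading the word from its end, either each letter can be put in front of a point, or two
    consecutive generators have product 0. *)
Lemma cylinder_nonempty_or mu : (exists x : X, cylinder mu x) \/ P mu = 0.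
Proof.
elim: mu => [|i mu ih]; first by have [x _] := markov_nonempty; left; exists x.
case: mu ih => [|j mu] ih.
  by left; have [x xi] := markov_point i; exists x; apply/cylinder_cons.
case: ih => [[x xmu]|h]; last first.
  by right; rewrite word_projection_cons h mulr0 mul0r.
have [Aij|Aij] := A01 i j.
  right; rewrite !word_projection_cons !mulrA (ck_inadmissible ckS)//.
  by rewrite !mul0r.
left; have /cylinder_cons[xj _] := xmu; rewrite -xj in Aij.
have [y yi yx] := markov_cons Aij; exists y; apply/cylinder_cons.
by rewrite yx.
Qed.

(** Compressing [P (i :: mu)] by [S i] gives [star (S i) * S i * P mu], which is [P mu] when the
    first letter of [mu] may follow [i]; for the empty [mu], [ck_neq0] takes over. *)
Lemma word_projection_neq0 mu (x : X) : cylinder mu x -> P mu != 0.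
Proof.
elim: mu x => [|i mu ih] x; first by rewrite word_projection_nil oner_neq0.
move=> /cylinder_cons[xi xmu]; apply/eqP => h.
have : star (S i) * P (i :: mu) * S i = star (S i) * S i * P mu.
  transitivity (star (S i) * S i * (P mu * (star (S i) * S i))).
    by rewrite word_projection_cons !mulrA.
  rewrite -(ck_initial_comm ckS) mulrA; congr (_ * _).
  by rewrite -mulrA (mulrA (S i)) (ck_pi ckS).
rewrite h mulr0 mul0r => /esym; case: mu ih xmu h => [|j mu] ih xmu h.
  rewrite word_projection_nil mulr1 => /starMx_eq0/eqP.
  by rewrite (negbTE (ck_neq0 i)).
rewrite (ck_initial_word ckS); have /cylinder_cons[xj _] := xmu.
have := markovP x 0; rewrite xi -markov_shiftE xj => ->.
by rewrite mulr1n; apply/eqP; exact: ih xmu.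
Qed.

End Nonvanishing.

Lemma diag_congr (R : realType) (O : cstarAlgType R) (I : finType) (e : I -> O)
    (c d : I -> R[i]) :
  (forall i, e i != 0 -> c i = d i) -> diag e c = diag e d.
Proof.
move=> h; apply: eq_bigr => i _; have [->|ei] := eqVneq (e i) 0.
  by rewrite !scaler0.
by rewrite h.
Qed.

(** * Construction of the identification as a limit of step functions *)

Section Levels.
Variables (R : realType) (N : nat) (A : 'M[nat]_N).
Variables (O : cstarAlgType R) (S : 'I_N -> O).
Hypotheses (A01 : zero_one_matrix A) (irrA : irreducible_matrix A).
Hypothesis ckS : ck_family A S.
Local Notation X := (markov_space A).
Local Notation P := (word_projection S).
Variable x0 : X.
Implicit Types (f g : X -> R[i]) (x y : X) (m : R).

(* If the cylinder of [t] is empty this is [x0], but then [P t = 0]. *)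
Definition cyl_point n (t : n.-tuple 'I_N) : X := xget x0 (cylinder t).

Lemma cyl_point_agree n x : agree n (cyl_point (initial_word n x)) x.
Proof.
apply/initial_wordP/cylinder_initial_word; apply: xgetPex.
by exists x; exact/cylinder_initial_word.
Qed.

Lemma cyl_pointP n (t : n.-tuple 'I_N) : P t != 0 -> initial_word n (cyl_point t) = t.
Proof.
move=> Pt; have [h|/eqP] := cylinder_nonempty_or A01 irrA ckS t.
  by apply/cylinder_initial_word; exact: xgetPex.
by rewrite (negbTE Pt).
Qed.

(** A step-function approximation of the image of [f], sampled at one point of each cylinder of
    length [n]. *)
Definition level n f : O :=
  diag (fun t : n.-tuple 'I_N => P t) (fun t => f (cyl_point t)).

Section LevelAlgebra.
Variable n : nat.
Local Notation e := (fun t : n.-tuple 'I_N => P t).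

Lemma level_sa t : star (e t) = e t.
Proof. exact: word_projection_sa. Qed.

Lemma level_eM t u : e t * e u = if t == u then e t else 0.
Proof. by rewrite /= (word_projectionM ckS) ?size_tuple. Qed.

Lemma level_e1 : \sum_t e t = 1.
Proof. exact: word_projection_sum ckS n. Qed.

Lemma levelM f g : level n (fun x => f x * g x) = level n f * level n g.
Proof. by rewrite /level (diagM level_eM). Qed.

Lemma levelZD c f g : level n (fun x => c * f x + g x) = c *: level n f + level n g.
Proof. exact: diagP. Qed.

Lemma level_star f : level n (fun x => (f x)^*%C) = star (level n f).
Proof. by rewrite /level (diag_star level_sa). Qed.

Lemma level_le f m : 0 <= m -> (forall x, cabs (f x) <= m) ->
  cnorm (level n f) <= m.
Proof. by move=> m0 fm; apply: (diag_norm_le level_sa level_eM level_e1). Qed.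

Lemma level_ge f x : cabs (f (cyl_point (initial_word n x))) <= cnorm (level n f).
Proof.
apply: (@diag_norm_ge _ _ _ e level_sa level_eM (fun t => f (cyl_point t))).
apply: (word_projection_neq0 A01 irrA ckS (x := x)); exact/cylinder_initial_word.
Qed.

End LevelAlgebra.

(** Refine [P t] into words of length [n]; the only one not orthogonal to [P u] can be [u] itself,
    which occurs when it begins with [t]. *)
Lemma word_projection_take k n (u : n.-tuple 'I_N) (t : k.-tuple 'I_N) :
  (k <= n)%N -> P u * P t = if take k u == t then P u else 0.
Proof.
move=> kn; rewrite -(word_projection_split ckS t (n - k)) mulr_sumr.
have szc (v : (n - k).-tuple 'I_N) : size u = size (t ++ v).
  by rewrite size_cat !size_tuple subnKC.
have uE : (u : seq _) = take k u ++ drop k u by rewrite cat_take_drop.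
have szt : size (take k u) = size t by rewrite size_takel ?size_tuple.
under eq_bigr do rewrite (word_projectionM ckS (szc _)) {1}uE eqseq_cat//.
case: eqP => _ /=; last by rewrite big1.
have szd : size (drop k u) == (n - k)%N by rewrite size_drop size_tuple.
rewrite (bigD1 (Tuple szd))//= eqxx big1 ?addr0// => v vd.
by rewrite eq_sym; case: eqP => // h; rewrite -val_eqE /= h eqxx in vd.
Qed.

Lemma level_stable k n f : (k <= n)%N ->
  (forall x y, agree k x y -> f x = f y) -> level n f = level k f.
Proof.
move=> kn fk; rewrite -[RHS]mul1r -(word_projection_sum ckS n) mulr_suml.
apply: eq_bigr => u _; rewrite mulr_sumr.
have szt : size (take k u) == k by rewrite size_takel ?size_tuple.
rewrite (bigD1 (Tuple szt))//= big1 => [|t tu]; last first.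
  rewrite -scalerAr word_projection_take//; case: eqP => [h|]; rewrite ?scaler0//.
  by rewrite -val_eqE /= h eqxx in tu.
have PT : P u * P (take k u) = P u.
  by have := word_projection_take u (Tuple szt) kn; rewrite eqxx.
rewrite addr0 -scalerAr PT.
have [->|Pu] := eqVneq (P u) 0; first by rewrite !scaler0.
congr (_ *: _); apply: fk; apply/initial_wordP.
have Pt : P (Tuple szt) != 0.
  by apply: contra Pu => /eqP h; rewrite -PT [P (take k u)]h mulr0.
rewrite (cyl_pointP Pt); have := congr1 (take k \o val) (cyl_pointP Pu).
move=> /= h; apply: val_inj => /=; rewrite -h.
by rewrite /mkseq -map_take take_iota (minn_idPl kn).
Qed.

Lemma level_chi n (t : n.-tuple 'I_N) : level n (chi R t) = P t.
Proof.
rewrite /level (@diag_congr _ _ _ _ _ (fun u => (u == t)%:R)); last first.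
  by move=> u Pu; rewrite chi_initial_word cyl_pointP.
rewrite /diag (bigD1 t)//= eqxx scale1r big1 ?addr0// => u /negbTE ->.
by rewrite scale0r.
Qed.

(* Both [level k f] and [level n f] are close to the common value at levels [k]
   and [n] of the locally constant [x |-> f (cyl_point (initial_word k x))]. *)
Lemma level_cauchy f (e : R) : Cspace f -> 0 < e ->
  exists k, forall n, (k <= n)%N -> cnorm (level n f - level k f) <= e.
Proof.
move=> /CspaceP cf e0; have [k hk] := cf (e / 2) (divr_gt0 e0 (ltr0n _ 2)).
exists k => n kn; pose g x := f (cyl_point (initial_word k x)).
have gk x y : agree k x y -> g x = g y by rewrite /g => /initial_wordP ->.
have near l : cnorm (level l f - level l g) <= e / 2.
  have -> : level l f - level l g = level l (fun x => -1 * g x + f x).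
    by rewrite levelZD scaleN1r addrC.
  apply: level_le => [|x]; first by rewrite divr_ge0// ltW.
  by rewrite mulN1r addrC ltW// hk//; exact: cyl_point_agree.
have := cnorm_tri (level n g) (level n f) (level k f).
have := near n; have := near k; rewrite (cnormC (level k f)) (level_stable kn gk).
lra.
Qed.

Lemma level_cvg f : Cspace f -> exists l, converges (level^~ f) l.
Proof.
move=> cf; have [e e0|l /convergesP h] := @cnorm_complete _ _ (level^~ f).
  have e30 : 0 < e / 3 by rewrite divr_gt0.
  have [k hk] := level_cauchy cf e30; exists k => p q kp kq.
  have := cnorm_tri (level k f) (level p f) (level q f).
  have := hk p kp; have := hk q kq; rewrite (cnormC (level q f)); lra.
by exists l.
Qed.

(** By [level_cvg], the default 0 can occur only outside [Cspace]. *)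
Definition iota_lim f : O := xget 0 [set l | converges (level^~ f) l].

Lemma iota_limP f : Cspace f -> converges (level^~ f) (iota_lim f).
Proof.
move=> cf; apply: (@xgetPex _ 0 [set l | converges (level^~ f) l]).
exact: level_cvg.
Qed.

Lemma iota_lim_unique f l : Cspace f -> converges (level^~ f) l -> iota_lim f = l.
Proof. by move=> cf; apply: converges_unique; exact: iota_limP. Qed.

Lemma iota_lim_le f m : Cspace f -> 0 <= m -> (forall x, cabs (f x) <= m) ->
  cnorm (iota_lim f) <= m.
Proof.
move=> cf m0 fm; apply: (converges_norm_le (n0 := 0%N) (iota_limP cf)) => n _.
exact: level_le.
Qed.

(** With [iota_lim_le], this makes [iota_lim] isometric for the supremum norm. At a deep level,
    [f x] is close to the sample in the cylinder of [x], whose word projection is nonzero. *)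
Lemma iota_lim_ge f x : Cspace f -> cabs (f x) <= cnorm (iota_lim f).
Proof.
move=> cf; apply: (converges_le_norm (iota_limP cf)) => e e0.
move/CspaceP: cf => /(_ e e0)[k hk]; exists k => n kn.
apply: le_trans (level_ge n f x); rewrite lerBlDr.
set y := cyl_point _; have -> : f x = f y + (f x - f y) by rewrite subrKC.
rewrite (le_trans (cabsD _ _))// lerD2l ltW// hk//.
by apply: (agree_le kn); exact: cyl_point_agree.
Qed.

Lemma iota_limZD c f g : Cspace f -> Cspace g ->
  iota_lim (fun x => c * f x + g x) = c *: iota_lim f + iota_lim g.
Proof.
move=> cf cg; apply: iota_lim_unique; first exact: (@CspaceZD _ _ _ _ _ _ cf cg).
rewrite (_ : level^~ _ = fun n => c *: level n f + level n g).
  exact: converges_lin (iota_limP cf) (iota_limP cg).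
by apply/funext => n; rewrite levelZD.
Qed.

Lemma iota_limM f g : Cspace f -> Cspace g ->
  iota_lim (fun x => f x * g x) = iota_lim f * iota_lim g.
Proof.
move=> cf cg; apply: iota_lim_unique; first exact: (@CspaceM _ _ _ _ _ cf cg).
rewrite (_ : level^~ _ = fun n => level n f * level n g).
  exact: converges_mul (iota_limP cf) (iota_limP cg).
by apply/funext => n; rewrite levelM.
Qed.

Lemma iota_lim_star f : Cspace f ->
  iota_lim (fun x => (f x)^*%C) = star (iota_lim f).
Proof.
move=> cf; apply: iota_lim_unique; first exact: Cspace_conj.
rewrite (_ : level^~ _ = fun n => star (level n f)).
  exact: converges_star (iota_limP cf).
by apply/funext => n; rewrite level_star.
Qed.

Lemma iota_limB f g : Cspace f -> Cspace g ->
  iota_lim (fun x => f x - g x) = iota_lim f - iota_lim g.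
Proof.
move=> cf cg; rewrite (_ : (fun x => f x - g x) = fun x => -1 * g x + f x).
  by rewrite iota_limZD// scaleN1r addrC.
by apply/funext => x; rewrite mulN1r addrC.
Qed.

Lemma iota_lim_inj f g : Cspace f -> Cspace g ->
  iota_lim f = iota_lim g -> f = g.
Proof.
move=> cf cg fg; apply/funext => x; apply/eqP; rewrite -subr_eq0; apply/eqP.
apply: cabs0_eq0; apply/eqP; rewrite eq_le cabs_ge0 andbT.
have := @iota_lim_ge (fun x => f x - g x) x.
by rewrite iota_limB// fg subrr cnorm0; apply; exact: (@CspaceB _ _ _ _ _ cf cg).
Qed.

Lemma iota_lim_chi mu : iota_lim (chi R mu) = P mu.
Proof.
apply: iota_lim_unique; first exact: Cspace_chi.
rewrite -[mu]/(val (in_tuple mu)); apply: (converges_eventually (n0 := size mu)).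
move=> n hn; rewrite (level_stable hn) ?level_chi// => x y /initial_wordP h.
by rewrite !chi_initial_word h.
Qed.

Lemma iota_lim_diagonal f : Cspace f -> diagonal_algebra S (iota_lim f).
Proof.
move=> cf; have DS := cstar_generated_subalgebra (range P).
have [_ _ _ cl] := DS; apply: (cl (level^~ f)); last exact/convergesP/iota_limP.
move=> n; apply: (@cstar_subalgebra_sum _ _ _ _ _ (fun t : n.-tuple 'I_N => P t)
  (fun t => f (cyl_point t)) DS) => t D [_ GD].
by apply: GD; exists (t : seq _).
Qed.

(** By [iota_lim_ge], preimages of a convergent sequence are uniformly Cauchy; their pointwise limit
    is then uniform, hence continuous, and it is a preimage of [l]. *)
Lemma iota_lim_closed (u : nat -> O) (l : O) :
  (forall n, (iota_lim @` @Cspace R N A) (u n)) -> converges u l ->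
  (iota_lim @` @Cspace R N A) l.
Proof.
move=> hu ul; have /choice[F hF] : forall n, exists f, Cspace f /\ iota_lim f = u n.
  by move=> n; have [f cf fu] := hu n; exists f.
have cF n : Cspace (F n) by case: (hF n).
have FE n : iota_lim (F n) = u n by case: (hF n).
have dF p q x : cabs (F p x - F q x) <= cnorm (u p - u q).
  rewrite -!FE -iota_limB//.
  exact: (@iota_lim_ge (fun x => F p x - F q x) x (@CspaceB _ _ _ _ _ (cF p) (cF q))).
have cauchy_u e : 0 < e -> exists n, forall p q, (n <= p)%N -> (n <= q)%N ->
    cnorm (u p - u q) < e.
  move=> e0; have [n hn] := ul _ (divr_gt0 e0 (ltr0n _ 2)); exists n => p q np nq.
  have := hn p np; have := hn q nq; have := cnorm_tri l (u p) (u q).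
  rewrite (cnormC l (u q)); lra.
have /choice[f hf] : forall x, exists l, forall e : R, 0 < e -> exists n,
    forall p, (n <= p)%N -> cabs (F p x - l) < e.
  move=> x; apply: complex_cauchy_converges => e /cauchy_u[n hn].
  by exists n => p q np nq; rewrite (le_lt_trans (dF _ _ _))// hn.
have unif e : 0 < e -> exists n, forall p x, (n <= p)%N -> cabs (F p x - f x) <= e.
  move=> /cauchy_u[n hn]; exists n => p x np; apply/ler_addgt0Pr => d d0.
  have [n' hn'] := hf x d d0.
  have := hn' _ (leq_maxr n n'); have := hn _ _ np (leq_maxl n n').
  have := dF p (maxn n n') x.
  have := cabsD (F p x - F (maxn n n') x) (F (maxn n n') x - f x).
  rewrite addrA subrK; lra.
have cf : Cspace f.
  apply/CspaceP => e e0; have e30 : 0 < e / 4 by rewrite divr_gt0.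
  have [n hn] := unif _ e30; have /CspaceP/(_ _ e30)[k hk] := cF n.
  exists k => x y yx; have := hk x y yx.
  have := hn n x (leqnn n); have := hn n y (leqnn n).
  have -> : f x - f y = (F n x - F n y) + (F n y - f y) - (F n x - f x) by ring.
  have := cabsD (F n x - F n y + (F n y - f y)) (- (F n x - f x)).
  have := cabsD (F n x - F n y) (F n y - f y); rewrite cabsN; lra.
exists f => //; apply: (converges_unique _ ul) => e e0.
have e20 : 0 < e / 2 by rewrite divr_gt0.
have [n hn] := unif _ e20; exists n => p np.
rewrite -FE -(iota_limB (cF p) cf).
have := @iota_lim_le (fun x => F p x - f x) (e / 2)
  (@CspaceB _ _ _ _ _ (cF p) cf) (ltW e20) (fun x => hn p x np); lra.
Qed.

Lemma iota_lim_image : iota_lim @` @Cspace R N A = diagonal_algebra S.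
Proof.
apply/seteqP; split=> [_ [f cf <-]|]; first exact: iota_lim_diagonal.
move=> d; apply; split; last first.
  by move=> _ [mu _ <-]; exists (chi R mu); [exact: Cspace_chi|exact: iota_lim_chi].
split.
- split=> [|c _ _ [f cf <-] [g cg <-]].
    (* Zero is written as a difference, so that [iota_limB] computes its image. *)
    exists (fun x => chi R [::] x - chi R [::] x); last first.
      by rewrite iota_limB ?subrr//; exact: Cspace_chi.
    exact: (@CspaceB _ _ _ _ _ (@Cspace_chi _ _ _ _) (@Cspace_chi _ _ _ _)).
  exists (fun x => c * f x + g x); last exact: iota_limZD.
  exact: (@CspaceZD _ _ _ _ _ _ cf cg).
- move=> _ _ [f cf <-] [g cg <-]; exists (fun x => f x * g x); last exact: iota_limM.
  exact: (@CspaceM _ _ _ _ _ cf cg).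
- move=> _ [f cf <-]; exists (fun x => (f x)^*%C); last exact: iota_lim_star.
  exact: Cspace_conj.
- by move=> u l hu /convergesP; exact: iota_lim_closed.
Qed.

Lemma iota_lim_canonical : canonical_identification S iota_lim.
Proof.
split.
- split=> [c f g cf cg|f g cf cg|f cf].
  + exact: iota_limZD.
  + exact: iota_limM.
  + exact: iota_lim_star.
- exact: iota_lim_inj.
- exact: iota_lim_image.
- exact: iota_lim_chi.
Qed.

End Levels.

(** * Uniqueness of the identification *)

Section CanonicalUniqueness.
Variables (R : realType) (N : nat) (A : 'M[nat]_N).
Variables (O : cstarAlgType R) (S : 'I_N -> O).
Local Notation X := (markov_space A).
Local Notation P := (word_projection S).
Variables (i1 i2 : (X -> R[i]) -> O).
Hypotheses (can1 : canonical_identification S i1).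
Hypotheses (can2 : canonical_identification S i2).

(* If [i1 f = i2 f'] with [f' x <> f x], then [f - f' x] is invertible on a
   small cylinder around [x], whereas [f' - f' x] vanishes at [x]. *)
Lemma canonical_identification_unique (f : X -> R[i]) : Cspace f -> i1 f = i2 f.
Proof.
have [[lin1 mul1 _] inj1 im1 chi1] := can1.
have [[lin2 mul2 _] inj2 im2 chi2] := can2.
move=> cf; have : (i2 @` @Cspace R N A) (i1 f).
  by rewrite im2 -im1; exists f.
case=> f' cf' e; rewrite -e; congr i2; apply/funext => x.
apply/eqP; apply/negPn/negP => fx; pose c := f' x.
have d0 : 0 < cabs (f x - c).
  rewrite lt_def cabs_ge0 andbT; apply: contra fx => /eqP/cabs0_eq0/eqP.
  by rewrite subr_eq0 eq_sym.
have /continuousC/(_ x _ d0)[n hn] := cf.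
pose t : seq 'I_N := initial_word n x; pose U := chi R (A := A) t.
have cU : Cspace U by exact: Cspace_chi.
pose one : X -> R[i] := fun x => chi R [::] x.
have c1 : Cspace one by exact: Cspace_chi.
have oneE y : one y = 1 by rewrite /one /chi /indic mem_set.
have UE y : U y = (initial_word n y == initial_word n x)%:R.
  by rewrite /U chi_initial_word.
(* [G k] is [k - c] on the cylinder and 1 off it. In this form [G1] and [G2] give the same
   expression in [i1 k] and [i2 k], so [G f] and [G f'] have the same image. *)
pose G (k : X -> R[i]) y := 1 * (k y * U y) + (- (c + 1) * U y + one y).
have cGU : Cspace (fun y => - (c + 1) * U y + one y) := @CspaceZD _ _ _ _ _ _ cU c1.
have cG k : Cspace k -> Cspace (G k).
  by move=> ck; exact (@CspaceZD _ _ _ 1 _ _ (@CspaceM _ _ _ _ _ ck cU) cGU).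
have GE k y : G k y = (k y - c) * U y + (1 - U y).
  by rewrite /G oneE; ring.
have G1 k : Cspace k -> i1 (G k) = i1 k * P t + (- (c + 1) *: P t + 1).
  move=> ck; rewrite /G (lin1 1 _ _ (@CspaceM _ _ _ _ _ ck cU) cGU) scale1r.
  rewrite (mul1 _ _ ck cU) (lin1 _ _ _ cU c1) [i1 U]chi1 [i1 one]chi1.
  by rewrite word_projection_nil.
have G2 k : Cspace k -> i2 (G k) = i2 k * P t + (- (c + 1) *: P t + 1).
  move=> ck; rewrite /G (lin2 1 _ _ (@CspaceM _ _ _ _ _ ck cU) cGU) scale1r.
  rewrite (mul2 _ _ ck cU) (lin2 _ _ _ cU c1) [i2 U]chi2 [i2 one]chi2.
  by rewrite word_projection_nil.
have G0 y : G f y != 0.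
  rewrite GE UE; have [/initial_wordP yx|_] := eqVneq (initial_word n y) _.
    rewrite mulr1 subrr addr0 subr_eq0; apply/eqP => fyc.
    by have := hn y yx; rewrite fyc ltxx.
  by rewrite mulr0 add0r subr0 oner_neq0.
have cV := @CspaceV _ _ _ _ G0 (cG _ cf).
have : (i2 @` @Cspace R N A) (i1 (fun y => (G f y)^-1)).
  by rewrite im2 -im1; exists (fun y => (G f y)^-1).
case=> k ck ke; have Gf' : i2 (G f') = i1 (G f) by rewrite G1// G2// e.
(* [i2] pulls the inverse of that common image back to an inverse [k] of [G f'], which vanishes at
   [x] because [c = f' x]. *)
have : (fun y => G f' y * k y) = one.
  apply (inj2 _ _ (@CspaceM _ _ _ _ _ (cG _ cf') ck) c1).
  rewrite (mul2 _ _ (cG _ cf') ck) Gf' ke -(mul1 _ _ (cG _ cf) cV).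
  rewrite [RHS]chi2 -chi1; congr i1; apply/funext => y.
  by rewrite mulfV//; exact/esym/oneE.
move=> /(congr1 (fun h => h x)); rewrite oneE GE UE eqxx subrr mul0r subrr add0r.
by rewrite mul0r => /esym/eqP; rewrite oner_eq0.
Qed.

End CanonicalUniqueness.

(** * Uniform density of step functions *)

Section Density.
Variables (R : realType) (N : nat) (A : 'M[nat]_N) (O : cstarAlgType R).
Local Notation X := (markov_space A).

Lemma chi_sum n (c : n.-tuple 'I_N -> R[i]) (x : X) :
  \sum_t c t * chi R t x = c (initial_word n x).
Proof.
rewrite (bigD1 (initial_word n x))//= chi_initial_word eqxx mulr1 big1 ?addr0//.
by move=> t tx; rewrite chi_initial_word eq_sym (negbTE tx) mulr0.
Qed.

Lemma Cspace_approx (f : X -> R[i]) (e : R) : Cspace f -> 0 < e ->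
  exists n (c : n.-tuple 'I_N -> R[i]),
    forall x, cabs (f x - \sum_t c t * chi R t x) <= e.
Proof.
move=> /CspaceP cf /cf[n hn].
(* The coefficient is the value of [f] at a chosen point of the cylinder, or 0 when the cylinder is
   empty. *)
exists n, (fun t => if pselect (exists x : X, cylinder t x) is left h
                    then f (projT1 (cid h)) else 0) => x.
rewrite chi_sum; case: pselect => [h|]; last first.
  by case; exists x; exact/cylinder_initial_word.
rewrite ltW// hn//; case: cid => y /= /cylinder_initial_word/initial_wordP; exact.
Qed.

(** Density principle: identities that are linear and bounded in [f] are proved below by applying it
    to the difference of their two sides. *)
Lemma bounded_linear_chi_eq0 (H : (X -> R[i]) -> O) (k : R) :
  (forall c f g, Cspace f -> Cspace g ->
     H (fun x => c * f x + g x) = c *: H f + H g) ->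
  (forall f m, Cspace f -> 0 <= m -> (forall x, cabs (f x) <= m) ->
     cnorm (H f) <= k * m) ->
  (forall mu, H (chi R mu) = 0) ->
  forall f, Cspace f -> H f = 0.
Proof.
move=> Hlin Hle Hchi f cf.
have H0 : H (fun=> 0) = 0.
  have := Hlin (-1) _ _ (@Cspace_chi _ A R [::]) (@Cspace_chi _ A R [::]).
  rewrite !Hchi scaler0 addr0 => <-; congr H; apply/funext => x.
  by rewrite mulN1r addNr.
have Hsum n (c : n.-tuple 'I_N -> R[i]) (s : seq (n.-tuple 'I_N)) :
    Cspace (fun x : X => \sum_(t <- s) c t * chi R t x) /\
    H (fun x => \sum_(t <- s) c t * chi R t x) = 0.
  elim: s => [|t s [ih1 ih2]].
    have -> : (fun x : X => \sum_(t <- [::]) c t * chi R t x) = fun=> 0.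
      by apply/funext => x; rewrite big_nil.
    by split; [exact (@Cspace_cst _ _ _ 0)|exact: H0].
  have -> : (fun x : X => \sum_(u <- t :: s) c u * chi R u x) =
      fun x => c t * chi R t x + \sum_(u <- s) c u * chi R u x.
    by apply/funext => x; rewrite big_cons.
  split; first exact (@CspaceZD _ _ _ _ _ _ (@Cspace_chi _ _ _ _) ih1).
  rewrite (Hlin _ _ _ (@Cspace_chi _ _ _ _) ih1).
  by rewrite Hchi ih2 scaler0 addr0.
apply: cnorm_le_eps => e e0; have k0 : 0 < `|k| + 1 by rewrite ltr_wpDl.
have d0 : 0 < e / (`|k| + 1) by rewrite divr_gt0.
have [n [c hc]] := Cspace_approx cf d0.
have [cs Hs] := Hsum n c (index_enum _).
have -> : H f = H (fun x => -1 * (\sum_t c t * chi R t x) + f x).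
  by rewrite (Hlin _ _ _ cs cf) Hs scaler0 add0r.
have := Hle (fun x => -1 * (\sum_t c t * chi R t x) + f x) (e / (`|k| + 1)).
move=> /(_ (@CspaceZD _ _ _ (-1) _ _ cs cf) (ltW d0) _) le.
apply: le_trans (le _) _ => [x|]; first by rewrite mulN1r addrC.
by rewrite mulrA ler_pdivrMr//; have := ler_norm k; nra.
Qed.

End Density.

(** * Commutation of the generators with the diagonal *)

Section DiagonalEmbedding.
Variables (R : realType) (N : nat) (A : 'M[nat]_N).
Variables (O : cstarAlgType R) (S : 'I_N -> O).
Hypotheses (A01 : zero_one_matrix A) (irrA : irreducible_matrix A).
Hypothesis ckS : ck_family A S.
Local Notation X := (markov_space A).
Local Notation P := (word_projection S).
Local Notation iota := (@of_Cspace R N A O S).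
Local Notation sigma := (@markov_shift N A).
Implicit Types (f g : X -> R[i]) (x y : X).

Lemma of_Cspace_canonical : canonical_identification S iota.
Proof.
rewrite /of_Cspace.
apply: (@xgetPex _ (fun=> 0) [set i | @canonical_identification R N A O S i]).
have [x _] := markov_nonempty A01 irrA ckS.
by exists (iota_lim S x); exact: iota_lim_canonical.
Qed.

(** [of_Cspace] is an arbitrary choice; uniqueness gives it the norm bound of [iota_lim]. *)
Lemma of_Cspace_le f m : Cspace f -> 0 <= m -> (forall x, cabs (f x) <= m) ->
  cnorm (iota f) <= m.
Proof.
have [x _] := markov_nonempty A01 irrA ckS => cf.
rewrite (canonical_identification_unique of_Cspace_canonical
  (iota_lim_canonical A01 irrA ckS x) cf).
exact: iota_lim_le.
Qed.

Lemma of_CspaceZD c f g : Cspace f -> Cspace g ->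
  iota (fun x => c * f x + g x) = c *: iota f + iota g.
Proof. by have [[h _ _] _ _ _] := of_Cspace_canonical; exact: h. Qed.

Lemma of_CspaceM f g : Cspace f -> Cspace g ->
  iota (fun x => f x * g x) = iota f * iota g.
Proof. by have [[_ h _] _ _ _] := of_Cspace_canonical; exact: h. Qed.

Lemma of_Cspace_star f : Cspace f -> iota (fun x => (f x)^*%C) = star (iota f).
Proof. by have [[_ _ h] _ _ _] := of_Cspace_canonical; exact: h. Qed.

Lemma of_Cspace_inj f g : Cspace f -> Cspace g -> iota f = iota g -> f = g.
Proof. by have [_ h _ _] := of_Cspace_canonical; exact: h. Qed.

Lemma of_Cspace_image : iota @` @Cspace R N A = diagonal_algebra S.
Proof. by have [_ _ h _] := of_Cspace_canonical; exact: h. Qed.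

Lemma of_Cspace_chi mu : iota (chi R mu) = P mu.
Proof. by have [_ _ _ h] := of_Cspace_canonical; exact: h. Qed.

Lemma of_Cspace_chi1 i : iota (chi R [:: i]) = S i * star (S i).
Proof. by rewrite of_Cspace_chi word_projection_cons word_projection_nil mulr1. Qed.

Lemma of_Cspace1 : iota (fun=> 1) = 1.
Proof.
rewrite -[RHS](word_projection_nil S) -of_Cspace_chi; congr iota.
by apply/funext => x; rewrite /chi /indic mem_set.
Qed.

Lemma of_CspaceC f g : Cspace f -> Cspace g -> iota f * iota g = iota g * iota f.
Proof.
move=> cf cg; rewrite -!of_CspaceM//; congr iota; apply/funext => x.
by rewrite mulrC.
Qed.

Lemma of_CspaceD f g : Cspace f -> Cspace g ->
  iota (fun x => f x + g x) = iota f + iota g.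
Proof.
move=> cf cg; rewrite -[iota f]scale1r -of_CspaceZD//; congr iota.
by apply/funext => x; rewrite mul1r.
Qed.

Lemma of_Cspace0 : iota (fun=> 0) = 0.
Proof.
have c1 := @Cspace_chi _ A R [::].
have := @of_CspaceZD (-1) _ _ c1 c1; rewrite scaleN1r addNr => <-.
by congr iota; apply/funext => x; rewrite mulN1r addNr.
Qed.

Lemma of_Cspace_sum (I : Type) (s : seq I) (F : I -> X -> R[i]) :
  (forall i, Cspace (F i)) ->
  iota (fun x => \sum_(i <- s) F i x) = \sum_(i <- s) iota (F i).
Proof.
move=> cF; elim: s => [|i s ih].
  rewrite big_nil -of_Cspace0; congr iota; apply/funext => x; exact: big_nil.
rewrite big_cons -ih -of_CspaceD//; last exact: Cspace_sum.
by congr iota; apply/funext => x; rewrite big_cons.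
Qed.

Lemma ck_norm_le1 j : cnorm (S j) <= 1.
Proof.
rewrite -(@ler_pXn2r _ 2) ?nnegrE ?cnorm_ge0// expr1n -cnorm_starM.
apply: cnorm_idem_le1; first by rewrite starM starK.
by rewrite mulrA (ck_pi_star ckS).
Qed.

(** On indicators this is [word_projection_cons]; each side is contractive in [f], so the difference
    is bounded by 2 and density applies. *)
Lemma ck_conj j f : Cspace f ->
  S j * iota f * star (S j) = iota (fun x => chi R [:: j] x * f (sigma x)).
Proof.
have cj g : Cspace g -> Cspace (fun x => chi R [:: j] x * g (sigma x)).
  by move=> cg; exact (@CspaceM _ _ _ _ _ (@Cspace_chi _ _ _ _) (Cspace_shift cg)).
pose H g := S j * iota g * star (S j) - iota (fun x => chi R [:: j] x * g (sigma x)).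
move=> cf; apply/eqP; rewrite -subr_eq0; apply/eqP; move: f cf.
apply: (@bounded_linear_chi_eq0 _ _ _ _ H 2).
- move=> c f g cf cg; rewrite /H (of_CspaceZD c cf cg).
  have -> : (fun x => chi R [:: j] x * (c * f (sigma x) + g (sigma x))) =
      fun x => c * (chi R [:: j] x * f (sigma x)) + chi R [:: j] x * g (sigma x).
    by apply/funext => x; rewrite mulrDr mulrCA.
  rewrite (of_CspaceZD c (cj _ cf) (cj _ cg)).
  rewrite mulrDr mulrDl -scalerAr -scalerAl scalerBr.
  by rewrite opprD addrACA.
- move=> f m cf m0 fm; rewrite /H (le_trans (cnormB _ _))//.
  have h1 : cnorm (iota (fun x => chi R [:: j] x * f (sigma x))) <= m.
    apply (of_Cspace_le (cj _ cf) m0) => x; rewrite cabsM chi1.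
    case: eqP => _ /=; last by rewrite cabs0 mul0r.
    by rewrite cabs1 mul1r.
  have h2 : cnorm (S j * iota f * star (S j)) <= m.
    rewrite (le_trans (cnormM _ _))// cnorm_star.
    rewrite -[leRHS]mulr1 ler_pM ?cnorm_ge0 ?ck_norm_le1//.
    rewrite (le_trans (cnormM _ _))// -[leRHS]mul1r.
    by rewrite ler_pM ?cnorm_ge0 ?ck_norm_le1 ?(of_Cspace_le cf m0 fm).
  by rewrite mulr2n mulrDl mul1r lerD.
- move=> mu; rewrite /H of_Cspace_chi -word_projection_cons -of_Cspace_chi.
  apply/eqP; rewrite subr_eq0; apply/eqP; congr iota; apply/funext => x.
  by rewrite chi_cons.
Qed.

Lemma ck_initialE j : star (S j) * S j = iota (fun x => (A j (set_val x 0%N))%:R).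
Proof.
have [_ _ ->] := ckS.
have -> : (fun x : X => (A j (set_val x 0%N))%:R) =
    fun x => \sum_k ((A j k)%:R * chi R [:: k] x) :> R[i].
  apply/funext => x; rewrite (bigD1 (set_val x 0%N))//= chi1 eqxx mulr1.
  rewrite big1 ?addr0// => k kx; rewrite chi1 eq_sym (negbTE kx) mulr0//.
rewrite of_Cspace_sum; last first.
  by move=> k; exact (@CspaceM _ _ _ _ _ (@Cspace_cst _ _ _ _) (@Cspace_chi _ _ _ _)).
apply: eq_bigr => k _; rewrite -of_Cspace_chi1 -scaler_nat.
have cc := @Cspace_chi _ A R [:: k].
have c0 := @Cspace_cst _ A R 0.
rewrite -[LHS]addr0 -of_Cspace0 -(of_CspaceZD _ cc c0); congr iota.
by apply/funext => x; rewrite addr0.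
Qed.

Lemma Cspace_initial j : Cspace (fun x : X => (A j (set_val x 0%N))%:R : R[i]).
Proof. by apply: (@Cspace_locally_constant _ _ _ _ 1%N) => x y xy; rewrite xy. Qed.

(** Write [S j] as [S j * (star (S j) * S j)], whose second factor lies in the diagonal and commutes
    with [iota f]; [ck_conj] does the rest. *)
Lemma ck_shift j f : Cspace f -> S j * iota f = iota (f \o sigma) * S j.
Proof.
move=> cf; rewrite -{1}(ck_pi ckS j) -!mulrA (mulrA (star _)) ck_initialE.
rewrite (of_CspaceC (@Cspace_initial j) cf).
rewrite -ck_initialE !mulrA ck_conj//.
rewrite (of_CspaceM (@Cspace_chi _ _ _ _) (Cspace_shift cf)).
rewrite (of_CspaceC (@Cspace_chi _ _ _ _) (Cspace_shift cf)).
by rewrite of_Cspace_chi1 -mulrA (ck_pi ckS).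
Qed.

(** The inverse branch of the shift that prefixes [j]. *)
Definition markov_pre j x : X := xget x [set y | set_val y 0%N = j /\ sigma y = x].

Lemma markov_preP j x : A j (set_val x 0%N) = 1%N ->
  set_val (markov_pre j x) 0%N = j /\ sigma (markov_pre j x) = x.
Proof.
move=> h; have [y yj yx] := markov_cons h.
by apply: (@xgetPex _ x [set y | set_val y 0%N = j /\ sigma y = x]); exists y.
Qed.

Lemma markov_preK x : markov_pre (set_val x 0%N) (sigma x) = x.
Proof.
have [|h1 h2] := @markov_preP (set_val x 0%N) (sigma x); first exact: markovP.
exact: markov_cons_ext.
Qed.

(* The factor [A j _] kills the junk value of [markov_pre j x] when [j] cannot
   precede [x]. *)
Definition pull j f x : R[i] := (A j (set_val x 0%N))%:R * f (markov_pre j x).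

Lemma Cspace_pull j f : Cspace f -> Cspace (pull j f).
Proof.
move=> /CspaceP cf; apply/CspaceP => e e0; have [n hn] := cf e e0.
(* The successor ensures a common first letter even when [n] is 0, so that [j] may precede both
   points or neither. *)
exists n.+1 => x y yx; rewrite /pull (yx 0%N)//.
have [->|Aj] := A01 j (set_val x 0%N); first by rewrite !mul0r subrr cabs0.
have Ajy : A j (set_val y 0%N) = 1%N by rewrite (yx 0%N).
rewrite Aj !mul1r; apply: hn => -[|k] kn.
  by have [-> _] := markov_preP Aj; have [-> _] := markov_preP Ajy.
rewrite -!markov_shiftE; have [_ ->] := markov_preP Aj.
by have [_ ->] := markov_preP Ajy; apply: yx; rewrite ltnS ltnW// ltnW.
Qed.

(** On the cylinder of [j], [f] coincides with [pull j f \o sigma]; thus [ck_conj] applies backwards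
    and the flanking generators reduce to initial projections. *)
Lemma ck_pull j f : Cspace f -> star (S j) * iota f * S j = iota (pull j f).
Proof.
move=> cf; have cp : Cspace (pull j f) by exact: Cspace_pull.
have ca := @Cspace_initial j.
transitivity (star (S j) * (iota f * (S j * star (S j))) * S j).
  by rewrite -!mulrA (mulrA (S j)) (ck_pi ckS).
rewrite -of_Cspace_chi1 -(of_CspaceM cf (@Cspace_chi _ _ _ _)).
have -> : (fun x => f x * chi R [:: j] x) =
    fun x => chi R [:: j] x * pull j f (sigma x).
  apply/funext => x; rewrite chi1; case: eqP => [<-|]; last by rewrite mulr0 mul0r.
  by rewrite mulr1 mul1r /pull markov_preK markov_shiftE markovP mul1r.
rewrite -ck_conj// !mulrA -(mulrA _ (star _) (S j)) ck_initialE.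
rewrite -(of_CspaceM ca cp) -(of_CspaceM (@CspaceM _ _ _ _ _ ca cp) ca).
congr iota; apply/funext => x; rewrite /pull.
by have [->|->] := A01 j (set_val x 0%N); rewrite ?mul0r// !mul1r mulr1.
Qed.

End DiagonalEmbedding.

(** * Complex exponentials of real angles *)

Section Expi.
Variable R : realType.
Implicit Types a b : R.

Lemma expiD a b : expi (a + b) = expi a * expi b.
Proof. by rewrite /expi cosD sinD; simpc; rewrite [sin a * _ + _]addrC. Qed.

Lemma expi0 : expi (0 : R) = 1.
Proof. by rewrite /expi cos0 sin0. Qed.

Lemma expi_conj a : ((expi a)^*)%C = expi (- a).
Proof. by rewrite /expi cosN sinN. Qed.

Lemma expi_unit a : ((expi a)^*)%C * expi a = 1.
Proof. by rewrite expi_conj -expiD addNr expi0. Qed.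

Lemma expi_pi : expi (pi : R) = -1.
Proof. by rewrite /expi cospi sinpi; apply/eqP; rewrite eq_complex/= oppr0 !eqxx. Qed.

End Expi.

(** * Gauge actions as twists by diagonal unitaries *)

Section GaugeAction.
Variables (R : realType) (N : nat) (A : 'M[nat]_N).
Variables (O : cstarAlgType R) (S : 'I_N -> O).
Hypotheses (A01 : zero_one_matrix A) (irrA : irreducible_matrix A).
Hypothesis ckA : cuntz_krieger A S.
Local Notation X := (markov_space A).
Local Notation P := (word_projection S).
Local Notation iota := (@of_Cspace R N A O S).
Local Notation sigma := (@markov_shift N A).
Implicit Types (f u : X -> R[i]) (g : X -> int) (x y : X).

Let ckS : ck_family A S. Proof. by have [] := ckA. Qed.

Lemma ck_ext (E : cstarAlgType R) (phi psi : O -> E) :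
  star_morphism phi -> star_morphism psi -> (forall j, phi (S j) = psi (S j)) ->
  phi = psi.
Proof.
have [_ gen _] := ckA => mphi mpsi h; apply: (eq_on_generators mphi mpsi gen).
by move=> _ [j _ <-].
Qed.

Lemma iota_unitary u : Cspace u -> (forall x, (u x)^*%C * u x = 1) ->
  star (iota u) * iota u = 1 /\ iota u * star (iota u) = 1.
Proof.
move=> cu u1; have cu' := Cspace_conj cu.
have e : star (iota u) * iota u = 1.
  rewrite -(of_Cspace_star A01 irrA ckS cu) -(of_CspaceM A01 irrA ckS cu' cu).
  rewrite -[RHS](of_Cspace1 A01 irrA ckS); congr iota.
  by apply/funext => x; exact: u1.
split=> //; rewrite -[RHS]e -(of_Cspace_star A01 irrA ckS cu).
exact (of_CspaceC A01 irrA ckS cu cu').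
Qed.

Lemma iota_comm_word u mu : Cspace u -> iota u * P mu = P mu * iota u.
Proof.
move=> cu; rewrite -(of_Cspace_chi A01 irrA ckS).
exact (of_CspaceC A01 irrA ckS cu (@Cspace_chi _ _ _ _)).
Qed.

(** A diagonal unitary commutes with the range projections and cancels in the initial ones, so
    neither changes. *)
Lemma ck_family_twist u : Cspace u -> (forall x, (u x)^*%C * u x = 1) ->
  ck_family A (fun j => iota u * S j).
Proof.
move=> cu u1; have [uu uu'] := iota_unitary cu u1.
have TT j : iota u * S j * star (iota u * S j) = S j * star (S j).
  rewrite starM mulrA -(mulrA (iota u)).
  have := iota_comm_word [:: j] cu.
  rewrite word_projection_cons word_projection_nil mulr1 => ->.
  by rewrite -mulrA uu' mulr1.
split.
- move=> j; rewrite /partial_isometry TT mulrA.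
  have := iota_comm_word [:: j] cu.
  rewrite word_projection_cons word_projection_nil mulr1 => <-.
  by rewrite -mulrA (ck_pi ckS).
- by under eq_bigr do rewrite TT; rewrite (ck_sum ckS).
- move=> i; under eq_bigr do rewrite TT.
  have [_ _ <-] := ckS; rewrite starM -mulrA (mulrA (star (iota u))) uu mul1r.
  by [].
Qed.

(** Word projections are fixed by induction on the word, since [iota u] commutes with them; density
    extends this to all continuous functions. *)
Lemma twist_fixes_diagonal u (phi : O -> O) : Cspace u ->
  (forall x, (u x)^*%C * u x = 1) -> star_morphism phi ->
  (forall j, phi (S j) = iota u * S j) ->
  forall f, Cspace f -> phi (iota f) = iota f.
Proof.
move=> cu u1 mphi phiS f cf; have [uu uu'] := iota_unitary cu u1.
apply/eqP; rewrite -subr_eq0; apply/eqP; move: f cf.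
apply: (@bounded_linear_chi_eq0 _ _ _ _ (fun f => phi (iota f) - iota f) 2).
- move=> c f f' cf cg; rewrite (of_CspaceZD A01 irrA ckS c cf cg).
  by rewrite (morphismP mphi) scalerBr opprD addrACA.
- move=> f m cf m0 fm; have fle := of_Cspace_le A01 irrA ckS cf m0 fm.
  rewrite (le_trans (cnormB _ _))// mulr2n mulrDl mul1r lerD//.
  by rewrite (le_trans (morphism_contractive mphi _)).
- move=> mu; rewrite (of_Cspace_chi A01 irrA ckS); apply/eqP.
  rewrite subr_eq0; apply/eqP; elim: mu => [|i mu ih].
    by rewrite word_projection_nil (morphism1 mphi).
  rewrite word_projection_cons 2!(morphismM mphi) (morphism_star mphi) ih phiS.
  rewrite starM; transitivity (iota u * P (i :: mu) * star (iota u)).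
    by rewrite word_projection_cons !mulrA.
  rewrite (iota_comm_word _ cu) -mulrA uu' mulr1 word_projection_cons.
  by [].
Qed.

(** The twist by the conjugate of [u] is the inverse: each twist fixes the diagonal, so the two
    unitaries cancel on generators. *)
Lemma twist_isomorphism u : Cspace u -> (forall x, (u x)^*%C * u x = 1) ->
  exists phi : O -> O, star_isomorphism phi /\ forall j, phi (S j) = iota u * S j.
Proof.
move=> cu u1; have cv := Cspace_conj cu; have [uu uu'] := iota_unitary cu u1.
have v1 x : ((u x)^*%C)^*%C * (u x)^*%C = 1 by rewrite conjcK mulrC.
have [_ _ univ] := ckA.
have [phi [mphi phiS]] := univ _ _ (ck_family_twist cu u1).
have [psi [mpsi psiS]] := univ _ _ (ck_family_twist cv v1).
exists phi; split=> //; split=> //; exists psi => x.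
- have : psi \o phi = @id O.
    apply: ck_ext => [||j]; [exact: star_morphism_comp|exact: star_morphism_id|].
    rewrite /= phiS (morphismM mpsi) psiS.
    rewrite (twist_fixes_diagonal cv v1 mpsi psiS cu) mulrA.
    by rewrite (of_Cspace_star A01 irrA ckS cu) uu' mul1r.
  by move=> /(congr1 (fun F => F x)).
- have : phi \o psi = @id O.
    apply: ck_ext => [||j]; [exact: star_morphism_comp|exact: star_morphism_id|].
    rewrite /= psiS (morphismM mphi) phiS.
    rewrite (twist_fixes_diagonal cu u1 mphi phiS cv) mulrA.
    by rewrite (of_Cspace_star A01 irrA ckS cu) uu mul1r.
  by move=> /(congr1 (fun F => F x)).
Qed.

Definition phase (g : X -> int) (t : R) x : R[i] := expi (2 * pi * t * (g x)%:~R).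

Lemma Cspace_phase g t : Cspace_int g -> Cspace (phase g t).
Proof.
exact (@Cspace_int_comp _ _ _ g (fun n => expi (2 * pi * t * n%:~R))).
Qed.

Lemma phase_unit g t x : (phase g t x)^*%C * phase g t x = 1.
Proof. exact: expi_unit. Qed.

Lemma gauge_actionP g t : Cspace_int g ->
  star_isomorphism (gauge_action S g t) /\
  forall j, gauge_action S g t (S j) = iota (phase g t) * S j.
Proof.
move=> cg; rewrite /gauge_action.
apply: (@xgetPex _ (fun x : O => x) [set alpha | star_isomorphism alpha /\
    forall j, alpha (S j) = iota (phase g t) * S j]).
exact (twist_isomorphism (@Cspace_phase g t cg) (phase_unit g t)).
Qed.

Lemma gauge_action_morphism g t : Cspace_int g ->
  star_morphism (gauge_action S g t).
Proof. by move=> /(gauge_actionP t)[[]]. Qed.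

Lemma gauge_actionS g t j : Cspace_int g ->
  gauge_action S g t (S j) = iota (phase g t) * S j.
Proof. by move=> /(gauge_actionP t)[_ ->]. Qed.

Lemma gauge_action_diagonal g t f : Cspace_int g -> Cspace f ->
  gauge_action S g t (iota f) = iota f.
Proof.
move=> cg cf; have [[mphi _] phiS] := gauge_actionP t cg.
exact (twist_fixes_diagonal (@Cspace_phase g t cg) (phase_unit g t) mphi phiS cf).
Qed.

(** By [ck_shift], moving the adjoint of the phase to the left of [S j] composes it with the shift,
    which produces the phase of the coboundary. *)
Lemma gauge_action_coboundary (g : X -> int) t : Cspace_int g ->
  Cspace_int (fun x => g x - g (sigma x)) ->
  gauge_action S (fun x => g x - g (sigma x)) t =
  fun z => iota (phase g t) * z * star (iota (phase g t)).
Proof.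
move=> cg cg'; have cv := @Cspace_phase g t cg.
have [uu uu'] := iota_unitary cv (phase_unit g t).
apply: ck_ext => [||j]; first exact: gauge_action_morphism.
  split=> [c x y|/=|x /=].
  - by rewrite mulrDr mulrDl -scalerAr -scalerAl.
  - split=> [|x y]; first by rewrite /= mulr1.
    by rewrite /= !mulrA -(mulrA _ (star _) (iota _)) uu mulr1.
  - by rewrite !starM starK mulrA.
rewrite (gauge_actionS _ _ cg') -mulrA -(of_Cspace_star A01 irrA ckS cv).
rewrite (ck_shift A01 irrA ckS j (Cspace_conj cv)) mulrA; congr (_ * _).
rewrite -(of_CspaceM A01 irrA ckS cv (Cspace_shift (Cspace_conj cv))).
congr iota; apply/funext => x; rewrite -[RHS]/(phase g t x * (phase g t (sigma x))^*%C).
rewrite /phase expi_conj -expiD; congr expi.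
by rewrite intrB mulrBr.
Qed.

End GaugeAction.

(** * The sum of the generators and the transfer operator *)

Section SumOfGenerators.
Variables (R : realType) (N : nat) (A : 'M[nat]_N).
Variables (O : cstarAlgType R) (S : 'I_N -> O).
Hypotheses (A01 : zero_one_matrix A) (irrA : irreducible_matrix A).
Hypothesis ckS : ck_family A S.
Local Notation X := (markov_space A).
Local Notation iota := (@of_Cspace R N A O S).
Local Notation sigma := (@markov_shift N A).
Implicit Types (f : X -> R[i]) (x y : X).

Definition ck_total : O := \sum_j S j.
Local Notation W := ck_total.

Lemma ck_total_letter i : iota (chi R [:: i]) * W = S i.
Proof.
rewrite (of_Cspace_chi1 A01 irrA ckS) mulr_sumr (bigD1 i)//= (ck_pi ckS).
rewrite big1 ?addr0// => j ji; rewrite -mulrA (ck_orthogonal ckS) ?mulr0//.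
by rewrite eq_sym.
Qed.

Lemma ck_total_shift f : Cspace f -> W * iota f = iota (f \o sigma) * W.
Proof.
move=> cf; rewrite mulr_suml mulr_sumr; apply: eq_bigr => j _.
exact: (ck_shift A01 irrA ckS j cf).
Qed.

Lemma iota_comm_range j f : Cspace f ->
  iota f * (S j * star (S j)) = S j * star (S j) * iota f.
Proof.
move=> cf; rewrite -(of_Cspace_chi1 A01 irrA ckS).
exact (of_CspaceC A01 irrA ckS cf (@Cspace_chi _ _ _ _)).
Qed.

Lemma iota_mulS j f : Cspace f -> iota f * S j = S j * iota (pull j f).
Proof.
move=> cf; rewrite -(ck_pull A01 irrA ckS j cf).
rewrite !mulrA -iota_comm_range// -mulrA (ck_pi ckS).
by [].
Qed.

(** Moving [iota f] past [S k] leaves [star (S j) * S k], so only the terms with equal indices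
    survive. *)
Lemma ck_total_transfer f : Cspace f ->
  star W * iota f * W = iota (fun x => \sum_j pull j f x).
Proof.
move=> cf; have cp j : Cspace (pull j f) by exact: Cspace_pull.
rewrite (of_Cspace_sum A01 irrA ckS _ cp) star_sum !mulr_suml; apply: eq_bigr => j _.
rewrite mulr_sumr (bigD1 j)//= (ck_pull A01 irrA ckS j cf) big1 ?addr0// => k kj.
rewrite -mulrA iota_mulS// mulrA (ck_orthogonal ckS) ?mul0r//.
by rewrite eq_sym.
Qed.

(* The mixed terms [S j * star (S k)] vanish between [iota f] and itself since
   no two distinct points of the support of [f] have the same image by the shift. *)
Lemma ck_total_range f : Cspace f -> (forall x, (f x)^*%C = f x) ->
  (forall x, f x * f x = f x) ->
  (forall x y, f x != 0 -> f y != 0 -> sigma x = sigma y -> x = y) ->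
  iota f * W * star W * iota f = iota f.
Proof.
move=> cf fr ff finj.
have sf : star (iota f) = iota f.
  rewrite -(of_Cspace_star A01 irrA ckS cf); congr iota; exact/funext.
have idf : iota f * iota f = iota f.
  rewrite -(of_CspaceM A01 irrA ckS cf cf); congr iota; exact/funext.
rewrite star_sum -[iota f * W * _]mulrA mulr_suml mulr_sumr mulr_suml.
have rhs : iota f = \sum_j iota f * (S j * star (S j)) * iota f.
  by rewrite -mulr_suml -mulr_sumr (ck_sum ckS) mulr1 idf.
rewrite [RHS]rhs; apply: eq_bigr => j _; rewrite !mulr_sumr mulr_suml.
rewrite (bigD1 j)//= big1 ?addr0// => k kj; rewrite -!mulrA.
have -> : star (S k) * iota f = star (iota (pull k f)) * star (S k).
  by rewrite -{1}sf -!starM iota_mulS.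
rewrite mulrA iota_mulS// !mulrA -(mulrA (S j)).
have cj : Cspace (pull j f) by exact: Cspace_pull.
have ck : Cspace (pull k f) by exact: Cspace_pull.
rewrite -(of_Cspace_star A01 irrA ckS ck).
rewrite -(of_CspaceM A01 irrA ckS cj (Cspace_conj ck)).
rewrite [X in iota X](_ : _ = fun=> 0).
  by rewrite (of_Cspace0 A01 irrA ckS) mulr0 mul0r.
apply/funext => x; apply/eqP; rewrite mulf_eq0 conjc_eq0.
apply/negP => /negP; rewrite negb_or => /andP[].
rewrite /pull; have [->|Aj] := A01 j (set_val x 0%N); first by rewrite mul0r eqxx.
have [->|Ak] := A01 k (set_val x 0%N); first by rewrite mul0r eqxx.
rewrite Aj Ak !mul1r => h1 h2.
have [j1 j2] := markov_preP Aj; have [k1 k2] := markov_preP Ak.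
have := finj _ _ h1 h2; rewrite j2 k2 => /(_ erefl) e.
by move: kj; rewrite -k1 -j1 e eqxx.
Qed.

End SumOfGenerators.

(** * The isomorphism induced by a conjugacy *)

Section Conjugacy.
Variables (R : realType) (N M : nat) (A : 'M[nat]_N) (B : 'M[nat]_M).
Variables (OA OB : cstarAlgType R) (S : 'I_N -> OA) (T : 'I_M -> OB).
Hypotheses (A01 : zero_one_matrix A) (B01 : zero_one_matrix B).
Hypotheses (irrA : irreducible_matrix A) (irrB : irreducible_matrix B).
Hypotheses (ckA : cuntz_krieger A S) (ckB : cuntz_krieger B T).
Local Notation XA := (markov_space A).
Local Notation XB := (markov_space B).
Variables (h : XA -> XB) (hinv : XB -> XA).
Hypothesis hh : homeomorphism h hinv.
Local Notation iotaA := (@of_Cspace R N A OA S).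
Local Notation iotaB := (@of_Cspace R M B OB T).
Local Notation sA := (@markov_shift N A).
Local Notation sB := (@markov_shift M B).

Let ckS : ck_family A S. Proof. by have [] := ckA. Qed.
Let ckT : ck_family B T. Proof. by have [] := ckB. Qed.

Let ch : continuous h. Proof. by have [] := hh. Qed.
Let chinv : continuous hinv. Proof. by have [] := hh. Qed.
Let hK x : hinv (h x) = x. Proof. by have [_ _ e _] := hh; exact: e. Qed.
Let hinvK y : h (hinv y) = y. Proof. by have [_ _ _ e] := hh; exact: e. Qed.

Section Construction.
Hypothesis hs : h \o sA = sB \o h.

Let hsE x : h (sA x) = sB (h x).
Proof. exact: (congr1 (fun F => F x) hs). Qed.

Let hinvs y : hinv (sB y) = sA (hinv y).
Proof. by rewrite -{1}(hinvK y) -hsE hK. Qed.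

Definition letter_image i : XB -> R[i] := chi R [:: i] \o hinv.
Local Notation c := letter_image.

Let c_C i : Cspace (c i).
Proof. exact (Cspace_comp chinv (@Cspace_chi _ _ _ _)). Qed.

Let cE i y : c i y = (set_val (hinv y) 0%N == i)%:R.
Proof. exact: chi1. Qed.

Let c_conj i y : (c i y)^*%C = c i y.
Proof. by rewrite cE conjc_nat. Qed.

Let c_idem i y : c i y * c i y = c i y.
Proof. by rewrite cE; case: eqP; rewrite ?mulr1 ?mulr0. Qed.

(** The last hypothesis of [ck_total_range]: the shift is injective on the cylinder of a letter, and
    the conjugacy transports this. *)
Let c_inj i x y : c i x != 0 -> c i y != 0 -> sB x = sB y -> x = y.
Proof.
rewrite !cE; have [xi _|_] := eqVneq (set_val (hinv x) 0%N); last by rewrite eqxx.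
have [yi _ e|_] := eqVneq (set_val (hinv y) 0%N); last by rewrite eqxx.
rewrite -(hinvK x) -(hinvK y); congr h; apply: markov_cons_ext.
  by rewrite xi yi.
by rewrite -!hinvs e.
Qed.

Let c_sum y : \sum_i c i y = 1.
Proof.
rewrite (bigD1 (set_val (hinv y) 0%N))//= cE eqxx big1 ?addr0// => i iy.
by rewrite cE eq_sym (negbTE iy).
Qed.

(** The sum counts the preimages of [y] under [sB] in the image of the cylinder of [i]; through [h]
    these are the preimages of [hinv y] that start with [i]. *)
Let c_transfer i y : \sum_j pull j (c i) y = (A i (set_val (hinv y) 0%N))%:R.
Proof.
have preA j : B j (set_val y 0%N) = 1%N -> set_val (hinv (markov_pre j y)) 0%N = i ->
    sA (hinv (markov_pre j y)) = hinv y.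
  by move=> Bj _; rewrite -hinvs; have [_ ->] := markov_preP Bj.
have [Ai|Ai] := A01 i (set_val (hinv y) 0%N).
  rewrite Ai big1// => j _; rewrite /pull.
  have [->|Bj] := B01 j (set_val y 0%N); first by rewrite mul0r.
  rewrite Bj mul1r cE; case: eqP => // e.
  have := markovP (hinv (markov_pre j y)) 0; rewrite e -markov_shiftE preA// Ai.
  by [].
(* The single contribution comes from [h x], where [x] is [hinv y] preceded by [i]. *)
have [x xi xy] := markov_cons Ai.
have sx : sB (h x) = y by rewrite -hsE xy hinvK.
have Bx : B (set_val (h x) 0%N) (set_val y 0%N) = 1%N.
  by rewrite -sx; exact: markovP.
rewrite Ai (bigD1 (set_val (h x) 0%N))//= big1 => [|j jx].
  rewrite addr0 /pull Bx mul1r -[in markov_pre _ y]sx markov_preK cE hK xi.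
  by rewrite eqxx.
rewrite /pull; have [->|Bj] := B01 j (set_val y 0%N); first by rewrite mul0r.
rewrite Bj mul1r cE; case: eqP => // e.
have hx : hinv (markov_pre j y) = x.
  by apply: markov_cons_ext; rewrite ?e ?xi// preA.
have [pj _] := markov_preP Bj; move: jx.
by rewrite -hx hinvK pj eqxx.
Qed.

Local Notation W := (ck_total T).

Let e_idem i : iotaB (c i) * iotaB (c i) = iotaB (c i).
Proof.
by rewrite -(of_CspaceM B01 irrB ckT (@c_C i) (@c_C i)); congr iotaB; exact/funext.
Qed.

Let e_sa i : star (iotaB (c i)) = iotaB (c i).
Proof.
by rewrite -(of_Cspace_star B01 irrB ckT (@c_C i)); congr iotaB; exact/funext.
Qed.

Let eWWe i : iotaB (c i) * W * star W * iotaB (c i) = iotaB (c i).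
Proof.
exact: (ck_total_range B01 irrB ckT (@c_C i) (@c_conj i) (@c_idem i) (@c_inj i)).
Qed.

(** Range projections come from [eWWe], initial projections from the transfer operator at [c i]. *)
Lemma conjugate_ck_family : ck_family A (fun i => iotaB (c i) * W).
Proof.
have TT i : iotaB (c i) * W * star (iotaB (c i) * W) = iotaB (c i).
  by rewrite starM e_sa mulrA eWWe.
split.
- by move=> i; rewrite /partial_isometry TT mulrA e_idem.
- under eq_bigr do rewrite TT.
  rewrite -(of_Cspace_sum B01 irrB ckT _ c_C) -[LHS](of_Cspace1 B01 irrB ckT).
  by congr iotaB; apply/funext => y; rewrite c_sum.
- move=> i; under eq_bigr do rewrite TT.
  rewrite starM e_sa -!mulrA (mulrA (iotaB _)) e_idem mulrA.
  rewrite (ck_total_transfer B01 irrB ckT (@c_C i)).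
  under [RHS]eq_bigr do rewrite -scaler_nat.
  have cc j : Cspace (fun y => (A i j)%:R * c j y).
    exact (@CspaceM _ _ _ _ _ (@Cspace_cst _ _ _ _) (@c_C j)).
  have -> : \sum_j (A i j)%:R *: iotaB (c j) = \sum_j iotaB (fun y => (A i j)%:R * c j y).
    apply: eq_bigr => j _; rewrite -[LHS]addr0 -(of_Cspace0 B01 irrB ckT).
    rewrite -(of_CspaceZD B01 irrB ckT _ (@c_C j) (@Cspace_cst _ _ _ _)).
    by congr iotaB; apply/funext => y; rewrite addr0.
  rewrite -(of_Cspace_sum B01 irrB ckT _ cc); congr iotaB; apply/funext => y.
  rewrite c_transfer (bigD1 (set_val (hinv y) 0%N))//= cE eqxx mulr1 big1 ?addr0//.
  by move=> j jy; rewrite cE eq_sym (negbTE jy) mulr0.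
Qed.

Lemma conjugate_morphism : exists Phi : OA -> OB,
  [/\ star_morphism Phi, forall i, Phi (S i) = iotaB (c i) * W &
      forall a : XA -> R[i], Cspace a -> Phi (iotaA a) = iotaB (a \o hinv)].
Proof.
have [_ _ univ] := ckA; have [Phi [mPhi PhiS]] := univ _ _ conjugate_ck_family.
exists Phi; split=> // a ca; apply/eqP; rewrite -subr_eq0; apply/eqP; move: a ca.
apply: (@bounded_linear_chi_eq0 _ _ _ _
  (fun a => Phi (iotaA a) - iotaB (a \o hinv)) 2).
- move=> k f g cf cg; rewrite (of_CspaceZD A01 irrA ckS k cf cg) (morphismP mPhi).
  have := of_CspaceZD B01 irrB ckT k (Cspace_comp chinv cf) (Cspace_comp chinv cg).
  move=> e; rewrite [X in _ - X]e scalerBr opprD addrACA.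
  by [].
- move=> f m cf m0 fm; have fle := of_Cspace_le A01 irrA ckS cf m0 fm.
  rewrite (le_trans (cnormB _ _))// mulr2n mulrDl mul1r lerD//.
    by rewrite (le_trans (morphism_contractive mPhi _)).
  exact (of_Cspace_le B01 irrB ckT (Cspace_comp chinv cf) m0 (fun y => fm (hinv y))).
- move=> mu; rewrite (of_Cspace_chi A01 irrA ckS); apply/eqP.
  rewrite subr_eq0; apply/eqP; elim: mu => [|i mu ih].
    rewrite word_projection_nil (morphism1 mPhi) -(of_Cspace1 B01 irrB ckT).
    by congr iotaB; apply/funext => y; rewrite /chi /indic /= mem_set.
  rewrite word_projection_cons 2!(morphismM mPhi) (morphism_star mPhi) ih PhiS.
  have cmu : Cspace (chi R mu \o hinv).
    exact (Cspace_comp chinv (@Cspace_chi _ _ _ _)).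
  (* [W] moves past the function at the cost of a shift, and [eWWe] absorbs the remaining
     factors. *)
  rewrite starM e_sa -(mulrA _ W) (ck_total_shift B01 irrB ckT cmu).
  rewrite mulrA (of_CspaceC B01 irrB ckT (@c_C i) (Cspace_shift cmu)).
  rewrite !mulrA -2!(mulrA (iotaB (_ \o sB))) -(mulrA (iotaB (_ \o sB))) eWWe.
  rewrite -(of_CspaceM B01 irrB ckT (Cspace_shift cmu) (@c_C i)).
  by congr iotaB; apply/funext => y; rewrite /= chi_cons hinvs mulrC.
Qed.

(** With [W] sent to [W], the morphisms built from [h] and from [hinv] can be composed on
    generators. *)
Lemma conjugate_total (Phi : OA -> OB) : star_morphism Phi ->
  (forall i, Phi (S i) = iotaB (c i) * W) -> Phi (ck_total S) = W.
Proof.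
move=> mPhi PhiS; rewrite (morphism_sum mPhi).
under eq_bigr do rewrite PhiS.
rewrite -mulr_suml -(of_Cspace_sum B01 irrB ckT _ c_C).
rewrite [X in iotaB X](_ : _ = fun=> 1); first by rewrite of_Cspace1 ?mul1r.
by apply/funext => y; rewrite c_sum.
Qed.

End Construction.
End Conjugacy.

(** The construction for [hinv] gives the inverse: both composites fix the diagonal and the sum of
    generators, hence each generator by [ck_total_letter]. *)
Lemma conjugacy_isomorphism (R : realType) (N M : nat)
    (A : 'M[nat]_N) (B : 'M[nat]_M)
    (OA OB : cstarAlgType R) (S : 'I_N -> OA) (T : 'I_M -> OB)
    (A01 : zero_one_matrix A) (B01 : zero_one_matrix B)
    (irrA : irreducible_matrix A) (irrB : irreducible_matrix B)
    (ckA : cuntz_krieger A S) (ckB : cuntz_krieger B T)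
    (h : markov_space A -> markov_space B)
    (hinv : markov_space B -> markov_space A) :
  homeomorphism h hinv -> h \o @markov_shift N A = @markov_shift M B \o h ->
  exists Phi : OA -> OB,
    [/\ star_isomorphism Phi,
        forall i, Phi (S i) = of_Cspace T (letter_image R hinv i) * ck_total T
      & forall a : markov_space A -> R[i], Cspace a ->
          Phi (of_Cspace S a) = of_Cspace T (a \o hinv)].
Proof.
move=> hh hs; have [ch chinv hK hinvK] := hh.
have hh' : homeomorphism hinv h by [].
have hs' : hinv \o @markov_shift M B = @markov_shift N A \o hinv.
  apply/funext => y /=; rewrite -{1}(hinvK y).
  by rewrite -[markov_shift (h _)](congr1 (fun F => F (hinv y)) hs) /= hK.
have [Phi [mPhi PhiS Phii]] := conjugate_morphism A01 B01 irrA irrB ckA ckB hh hs.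
have [Psi [mPsi PsiT Psii]] := conjugate_morphism B01 A01 irrB irrA ckB ckA hh' hs'.
have PhiW := conjugate_total B01 irrB ckB hh mPhi PhiS.
have PsiW := conjugate_total A01 irrA ckA hh' mPsi PsiT.
have ckS : ck_family A S by case: ckA.
have ckT : ck_family B T by case: ckB.
have PsiPhi : Psi \o Phi = @id OA.
  apply: (ck_ext ckA) => [||i]; [exact: star_morphism_comp|exact: star_morphism_id|].
  rewrite /= PhiS (morphismM mPsi) PsiW.
  rewrite (Psii _ (Cspace_comp chinv (@Cspace_chi _ _ _ _))).
  rewrite -[RHS](ck_total_letter A01 irrA ckS).
  by congr (of_Cspace S _ * _); apply/funext => x; rewrite /= hK.
have PhiPsi : Phi \o Psi = @id OB.
  apply: (ck_ext ckB) => [||i]; [exact: star_morphism_comp|exact: star_morphism_id|].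
  rewrite /= PsiT (morphismM mPhi) PhiW.
  rewrite (Phii _ (Cspace_comp ch (@Cspace_chi _ _ _ _))).
  rewrite -[RHS](ck_total_letter B01 irrB ckT).
  by congr (of_Cspace T _ * _); apply/funext => x; rewrite /= hinvK.
exists Phi; split=> //; split=> //.
exists Psi => x; [exact: (congr1 (fun F => F x) PsiPhi)|].
exact: (congr1 (fun F => F x) PhiPsi).
Qed.

Lemma Cspace_int_continuous_comp (N M : nat) (A : 'M[nat]_N) (B : 'M[nat]_M)
    (h : markov_space A -> markov_space B) (f : markov_space B -> int) :
  continuous h -> Cspace_int f -> Cspace_int (f \o h).
Proof. by move=> ch cf x; apply: continuous_comp; [exact: ch|exact: cf]. Qed.

(** A gauge action fixes the diagonal and multiplies each generator, hence [W], by one and the same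
    phase; [Phi] carries the phase of [f \o h] to that of [f]. *)
Lemma conjugacy_gauge (R : realType) (N M : nat)
    (A : 'M[nat]_N) (B : 'M[nat]_M)
    (OA OB : cstarAlgType R) (S : 'I_N -> OA) (T : 'I_M -> OB)
    (A01 : zero_one_matrix A) (B01 : zero_one_matrix B)
    (irrA : irreducible_matrix A) (irrB : irreducible_matrix B)
    (ckA : cuntz_krieger A S) (ckB : cuntz_krieger B T)
    (h : markov_space A -> markov_space B)
    (hinv : markov_space B -> markov_space A)
    (Phi : OA -> OB) :
  homeomorphism h hinv -> star_morphism Phi ->
  (forall i, Phi (S i) = of_Cspace T (letter_image R hinv i) * ck_total T) ->
  (forall a : markov_space A -> R[i], Cspace a ->
     Phi (of_Cspace S a) = of_Cspace T (a \o hinv)) ->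
  forall (f : markov_space B -> int) (t : R), Cspace_int f ->
    Phi \o gauge_action S (f \o h) t = gauge_action T f t \o Phi.
Proof.
move=> [ch chinv hK hinvK] mPhi PhiS Phii f t cf.
have cfh := Cspace_int_continuous_comp ch cf.
have ckT : ck_family B T by case: ckB.
have cp := @Cspace_phase R _ _ f t cf.
have cl i : Cspace (letter_image R hinv i).
  exact (Cspace_comp chinv (@Cspace_chi _ _ _ _)).
have mA := gauge_action_morphism A01 irrA ckA t cfh.
have mB := gauge_action_morphism B01 irrB ckB t cf.
apply: (ck_ext ckA) => [||i]; [exact: star_morphism_comp|exact: star_morphism_comp|].
rewrite /= (gauge_actionS A01 irrA ckA t i cfh) (morphismM mPhi).
rewrite (Phii _ (@Cspace_phase R _ _ _ t cfh)) PhiS (morphismM mB).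
rewrite (gauge_action_diagonal B01 irrB ckB t cf (cl i)) (morphism_sum mB).
under [in RHS]eq_bigr do rewrite (gauge_actionS B01 irrB ckB t _ cf).
rewrite -mulr_sumr !mulrA (of_CspaceC B01 irrB ckT (cl i) cp).
by congr (of_Cspace T _ * _ * _); apply/funext => y; rewrite /phase /= hinvK.
Qed.

(** * Recovering the conjugacy from the gauge actions *)

Lemma gauge_conjugacy (R : realType) (N M : nat)
    (A : 'M[nat]_N) (B : 'M[nat]_M)
    (OA OB : cstarAlgType R) (S : 'I_N -> OA) (T : 'I_M -> OB)
    (A01 : zero_one_matrix A) (B01 : zero_one_matrix B)
    (irrA : irreducible_matrix A) (irrB : irreducible_matrix B)
    (ckA : cuntz_krieger A S) (ckB : cuntz_krieger B T)
    (h : markov_space A -> markov_space B)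
    (hinv : markov_space B -> markov_space A)
    (Phi : OA -> OB) :
  homeomorphism h hinv -> star_morphism Phi ->
  (forall a : markov_space A -> R[i], Cspace a ->
     Phi (of_Cspace S a) = of_Cspace T (a \o hinv)) ->
  (forall (f : markov_space B -> int) (t : R), Cspace_int f ->
    Phi \o gauge_action S (f \o h) t = gauge_action T f t \o Phi) ->
  h \o @markov_shift N A = @markov_shift M B \o h.
Proof.
move=> [ch chinv hK hinvK] mPhi Phii Phig; set sA := @markov_shift N A.
set sB := @markov_shift M B.
have ckS : ck_family A S by case: ckA.
have ckT : ck_family B T by case: ckB.
(* The shift of [A] transported by [h]; the goal becomes its equality with [sB]. *)
pose k y := h (sA (hinv y)).
have key (g : markov_space B -> int) (t : R) :
    Cspace_int g -> Cspace_int (fun y => g y - g (sB y)) ->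
    phase g t \o sB = phase g t \o k.
  move=> cg cf; set v := phase g t; set f := fun y => g y - g (sB y).
  have cv : Cspace v := @Cspace_phase R _ _ g t cg.
  have cvc := Cspace_conj cv; pose b y := (v y)^*%C.
  have cb : Cspace b := cvc.
  have cfh := Cspace_int_continuous_comp ch cf.
  have cbs := Cspace_shift cb.
  have cbk : Cspace (b \o k).
    exact (Cspace_comp chinv (Cspace_shift (Cspace_comp ch cb))).
  have [uu uu'] := iota_unitary B01 irrB ckB cv (phase_unit g t).
  (* At [S i], the intertwining relation equates multiplication by [v * (b \o sB)] with conjugation
     by [v]. Cancelling [v] on the left leaves [Phi (S i)] times the image of [b], which the shift
     relation for [S i] also computes. *)
  have sS i : of_Cspace T (b \o sB) * Phi (S i) = of_Cspace T (b \o k) * Phi (S i).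
    have /(congr1 (fun F => F (S i))) /= := Phig f t cf.
    rewrite (gauge_actionS A01 irrA ckA t i cfh) (morphismM mPhi).
    rewrite (Phii _ (@Cspace_phase R _ _ _ t cfh)).
    have -> : phase (f \o h) t \o hinv = fun y => v y * (b \o sB) y.
      apply/funext => y; rewrite -[LHS]/(phase f t (h (hinv y))) hinvK.
      rewrite -[RHS]/(phase g t y * (phase g t (sB y))^*%C) /phase expi_conj -expiD.
      by congr expi; rewrite intrB mulrBr.
    have -> : gauge_action T f t = _ := gauge_action_coboundary B01 irrB ckB t cg cf.
    rewrite (of_CspaceM B01 irrB ckT cv cbs) -!mulrA.
    move=> /(congr1 (fun z => star (of_Cspace T v) * z)); rewrite !mulrA uu !mul1r => ->.
    rewrite -(of_Cspace_star B01 irrB ckT cv).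
    have cbh := Cspace_comp ch cb.
    have := congr1 Phi (ck_shift A01 irrA ckS i cbh).
    rewrite !(morphismM mPhi) (Phii _ cbh) (Phii _ (Cspace_shift cbh)).
    have -> : (b \o h) \o hinv = b by apply/funext => y; rewrite /= hinvK.
    by [].
  have sum1 : \sum_i Phi (S i) * star (Phi (S i)) = 1.
    under eq_bigr do rewrite -(morphism_star mPhi) -(morphismM mPhi).
    by rewrite -(morphism_sum mPhi) (ck_sum ckS) (morphism1 mPhi).
  have bb : of_Cspace T (b \o sB) = of_Cspace T (b \o k).
    rewrite -[LHS]mulr1 -[RHS]mulr1 -sum1 !mulr_sumr; apply: eq_bigr => i _.
    by rewrite !mulrA sS.
  have e := of_Cspace_inj B01 irrB ckT cbs cbk bb.
  by apply/funext => y; exact: (can_inj (@conjcK R) (congr1 (fun F => F y) e)).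
suff kE y : k y = sB y.
  by apply/funext => x /=; rewrite -/(sB _) -kE /k hK.
apply: markov_ext => n; apply/eqP/negPn/negP => kn.
(* [g] tests agreement with [sB y]; the length [n.+1] includes position [n], where [k y] differs. *)
pose g (x : markov_space B) : int :=
  (initial_word n.+1 x == initial_word n.+1 (sB y))%:Z.
have cg : Cspace_int g.
  apply: (@Cspace_int_locally_constant _ _ g n.+1) => x x' /initial_wordP.
  by rewrite /g => ->.
have cf : Cspace_int (fun x => g x - g (sB x)).
  (* One more letter than for [g], since [sB] drops the first. *)
  apply: (@Cspace_int_locally_constant _ _ _ n.+2) => x x' xx'.
  have /initial_wordP e1 : agree n.+1 x x' by apply: (agree_le (n := n.+2)).
  have /initial_wordP e2 := agree_shift xx'.
  by rewrite /g e1 -/sB e2.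
(* At time 1/2 the phase is -1 where [g] is 1, and 1 where [g] is 0. *)
have := congr1 (fun F => F y) (key g (2^-1) cg cf); rewrite /= /phase /g eqxx.
have -> : (initial_word n.+1 (k y) == initial_word n.+1 (sB y)) = false.
  apply/negbTE; apply: contra kn => /eqP/initial_wordP e; apply/eqP.
  exact: e.
rewrite mulr0 expi0 mulr1 mulrAC divff ?pnatr_eq0// mul1r expi_pi.
by move=> /eqP; rewrite eq_sym -addr_eq0 -mulr2n pnatr_eq0.
Qed.

Theorem theorem1 (R : realType) (N M : nat) (A : 'M[nat]_N) (B : 'M[nat]_M)
    (A01 : zero_one_matrix A) (B01 : zero_one_matrix B)
    (irrA : irreducible_matrix A) (irrB : irreducible_matrix B)
    (npA : ~~ is_perm_mx A) (npB : ~~ is_perm_mx B)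
    (OA OB : cstarAlgType R) (S : 'I_N -> OA) (T : 'I_M -> OB)
    (ckA : cuntz_krieger A S) (ckB : cuntz_krieger B T) :
  (exists (h : markov_space A -> markov_space B)
          (hinv : markov_space B -> markov_space A),
     homeomorphism h hinv /\ h \o @markov_shift N A = @markov_shift M B \o h)
  <->
  (exists Phi : OA -> OB,
     [/\ star_isomorphism Phi,
         Phi @` diagonal_algebra S = diagonal_algebra T
       & exists (h : markov_space A -> markov_space B)
                (hinv : markov_space B -> markov_space A),
           [/\ homeomorphism h hinv,
               forall a : markov_space A -> R[i], Cspace a ->
                 Phi (of_Cspace S a) = of_Cspace T (a \o hinv)
             & forall (f : markov_space B -> int) (t : R), Cspace_int f ->
                 Phi \o gauge_action S (f \o h) t = gauge_action T f t \o Phi]]).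
Proof.
have ckS : ck_family A S by case: ckA.
have ckT : ck_family B T by case: ckB.
split=> [[h [hinv [hh hs]]]|]; last first.
  move=> [Phi [[mPhi _] _ [h [hinv [hh Phii Phig]]]]]; exists h, hinv; split=> //.
  exact: (gauge_conjugacy A01 B01 irrA irrB ckA ckB hh mPhi Phii Phig).
have [Phi [isoPhi PhiS Phii]] :=
  conjugacy_isomorphism A01 B01 irrA irrB ckA ckB hh hs.
have [mPhi _] := isoPhi; exists Phi; split=> //.
  (* Each diagonal is the image of the continuous functions, on which [Phi] acts as composition with
     the homeomorphism [hinv]. *)
  rewrite -(of_Cspace_image A01 irrA ckS) -(of_Cspace_image B01 irrB ckT).
  have [ch chinv hK hinvK] := hh.
  apply/seteqP; split=> [_ [_ [a ca <-] <-]|_ [b cb <-]].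
    by rewrite (Phii _ ca); exists (a \o hinv) => //; exact (Cspace_comp chinv ca).
  exists (of_Cspace S (b \o h)); first by exists (b \o h) => //; exact (Cspace_comp ch cb).
  rewrite (Phii _ (Cspace_comp ch cb)); congr of_Cspace.
  by apply/funext => y; rewrite /= hinvK.
exists h, hinv; split=> //.
exact: (conjugacy_gauge A01 B01 irrA irrB ckA ckB hh mPhi PhiS Phii).
Qed.
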